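(* Suppose that $M$ and $N$ are $3$-connected matroids such that $|E(N)| \geq 4$, and $C$ is a circuit of $M$ with the property that $M \backslash x_{0}$ has an $N$-minor for some $x_{0} \in C$. Then at least one of the following holds: (i) there is an element $x \in C$ such that $\operatorname{co}(M \backslash x)$ is $3$-connected and has an $N$-minor; (ii) there is an element $x \in C$ such that $\operatorname{si}(\operatorname{co}(M \backslash x))$ is $3$-connected and has an $N$-minor; or (iii) there is a four-element fan $(x_{1}, x_{2}, x_{3}, x_{4})$ in $M$ such that $x_{2}, x_{4} \in C$, and $\operatorname{co}(M \backslash x_{3})$ is $3$-connected with an $N$-minor.
   Context: All matroids are finite. For a matroid $M$ with ground set $E$ and rank function $r$, the connectivity function is $\lambda_M(X) = r(X) + r(E - X) - r(M)$ for $X \subseteq E$. A $k$-separation of $M$ is a partition $(X, E-X)$ of $E$ with $\lambda_M(X) < k$ and $|X|, |E-X| \geq k$. $M$ is $n$-connected if it has no $k$-separation for any $k < n$ ($k$ a positive integer). $\operatorname{si}(M)$ is the simple matroid associated with $M$ (delete all loops and all but one element of each parallel class), and $\operatorname{co}(M) = (\operatorname{si}(M^* ))^*$ is the cosimple matroid associated with $M$. A matroid has an $N$-minor if it has a minor isomorphic to $N$. A triangle is a three-element circuit and a triad is a three-element cocircuit. A four-element fan of $M$ is a sequence $(x_1,x_2,x_3,x_4)$ of distinct elements of $E(M)$ such that $\{x_1,x_2,x_3\}$ is a triangle and $\{x_2,x_3,x_4\}$ is a triad. *)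

(* Defs.v *)
From mathcomp Require Import all_boot.

Set Implicit Arguments.
Unset Strict Implicit.
Unset Printing Implicit Defensive.

(* A matroid whose ground set is a subset of the finite type T, given by its
   rank function.  Keeping T fixed lets the minors and the dual of M live over
   the same type.  The rank is extended to all subsets of T by ignoring the
   elements outside the ground set ([rk_ground]), so the remaining axioms need
   no side condition. *)
Record matroid (T : finType) := Matroid {
  ground : {set T};
  rk : {set T} -> nat;
  rk_ground : forall X, rk X = rk (X :&: ground);
  rk_card : forall X, rk X <= #|X|;
  rk_mono : forall X Y : {set T}, X \subset Y -> rk X <= rk Y;
  rk_submod : forall X Y : {set T}, rk (X :|: Y) + rk (X :&: Y) <= rk X + rk Y
}.

Section Constructions.
Variables (T : finType) (M : matroid T).
Local Notation E := (ground M).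
Local Notation r := (rk M).

Definition del_rk (D X : {set T}) := r (X :\: D).

Fact del_rk_ground D X : del_rk D X = del_rk D (X :&: (E :\: D)).
Proof.
rewrite /del_rk rk_ground [RHS]rk_ground; congr r.
by apply/setP=> x; rewrite !inE; case: (x \in D); rewrite ?andbF //= -andbA andbb.
Qed.

Fact del_rk_card D X : del_rk D X <= #|X|.
Proof. exact: leq_trans (rk_card _ _) (subset_leq_card (subsetDl _ _)). Qed.

Fact del_rk_mono D (X Y : {set T}) : X \subset Y -> del_rk D X <= del_rk D Y.
Proof. by move=> sXY; apply/rk_mono/setSD. Qed.

Fact del_rk_submod D X Y :
  del_rk D (X :|: Y) + del_rk D (X :&: Y) <= del_rk D X + del_rk D Y.
Proof. by rewrite /del_rk setDUl setDIl rk_submod. Qed.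

Definition delete (D : {set T}) : matroid T :=
  Matroid (del_rk_ground D) (del_rk_card D) (@del_rk_mono D)
          (del_rk_submod D).

Definition con_rk (C X : {set T}) := r (X :|: C) - r C.

Fact con_rk_ground C X : con_rk C X = con_rk C (X :&: (E :\: C)).
Proof.
rewrite /con_rk; congr (_ - _); rewrite rk_ground [RHS]rk_ground; congr r.
by apply/setP=> x; rewrite !inE; case: (x \in C); rewrite ?orbT ?orbF //= -andbA andbb.
Qed.

Fact con_rk_card C X : con_rk C X <= #|X|.
Proof.
rewrite /con_rk leq_subLR.
have := rk_submod M X C; have := rk_card M X => h1 h2.
apply: leq_trans (leq_trans (leq_addr _ _) h2) _.
by rewrite addnC leq_add2l.
Qed.

Fact con_rk_mono C (X Y : {set T}) : X \subset Y -> con_rk C X <= con_rk C Y.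
Proof. by move=> sXY; apply/leq_sub2r/rk_mono/setSU. Qed.

Fact con_rk_submod C X Y :
  con_rk C (X :|: Y) + con_rk C (X :&: Y) <= con_rk C X + con_rk C Y.
Proof.
have le Z : r C <= r (Z :|: C) by apply/rk_mono/subsetUr.
rewrite /con_rk -(leq_add2r (r C + r C)) addnACA [leqRHS]addnACA !subnK ?le //.
by rewrite setUUl setUIl rk_submod.
Qed.

Definition contract (C : {set T}) : matroid T :=
  Matroid (con_rk_ground C) (con_rk_card C) (@con_rk_mono C)
          (con_rk_submod C).

(* The subtraction never truncates: see [dual_rk_sub]. *)
Definition dual_rk (X : {set T}) := #|X :&: E| + r (E :\: X) - r E.

Fact dual_rk_sub X : r E <= #|X :&: E| + r (E :\: X).
Proof.
have := rk_submod M (X :&: E) (E :\: X).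
have -> : (X :&: E) :|: (E :\: X) = E by rewrite setIC setID.
move=> h; apply: leq_trans (leq_trans (leq_addr _ _) h) _.
by rewrite leq_add2r rk_card.
Qed.

Fact dual_rk_ground X : dual_rk X = dual_rk (X :&: E).
Proof. by rewrite /dual_rk -setIA setIid setDIr setDv setU0. Qed.

Fact dual_rk_card X : dual_rk X <= #|X|.
Proof.
rewrite /dual_rk leq_subLR addnC leq_add ?subset_leq_card ?subsetIl //.
exact/rk_mono/subsetDl.
Qed.

Fact dual_rk_mono (X Y : {set T}) : X \subset Y -> dual_rk X <= dual_rk Y.
Proof.
move=> sXY; apply: leq_sub2r.
have -> : E :\: X = (E :\: Y) :|: ((Y :\: X) :&: E).
  apply/setP=> x; rewrite !inE; have /implyP := subsetP sXY x.
  by case: (x \in X); case: (x \in Y); case: (x \in E).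
have le : r ((E :\: Y) :|: ((Y :\: X) :&: E)) <=
          r (E :\: Y) + #|(Y :\: X) :&: E|.
  apply: leq_trans (leq_trans (leq_addr _ _) (rk_submod _ _ _)) _.
  by rewrite leq_add2l rk_card.
apply: leq_trans (leq_add (leqnn _) le) _.
rewrite addnCA addnC leq_add2r -cardsUI.
have -> : X :&: E :&: ((Y :\: X) :&: E) = set0.
  by apply/setP=> x; rewrite !inE; case: (x \in X); rewrite ?andbF.
rewrite cards0 addn0; apply/subset_leq_card/subsetP=> x.
rewrite !inE; have /implyP := subsetP sXY x.
by case: (x \in X); case: (x \in Y); case: (x \in E).
Qed.

Fact dual_rk_submod X Y :
  dual_rk (X :|: Y) + dual_rk (X :&: Y) <= dual_rk X + dual_rk Y.
Proof.
rewrite /dual_rk -(leq_add2r (r E + r E)) addnACA [leqRHS]addnACA.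
rewrite !subnK ?dual_rk_sub // addnACA [leqRHS]addnACA.
rewrite setIUl setIIl cardsUI leq_add2l setDUr setDIr addnC.
exact: rk_submod.
Qed.

Definition dual : matroid T :=
  Matroid dual_rk_ground dual_rk_card dual_rk_mono dual_rk_submod.

End Constructions.

Section Notions.
Variables (T : finType) (M : matroid T).
Local Notation E := (ground M).
Local Notation r := (rk M).

Definition indep (X : {set T}) := (X \subset E) && (r X == #|X|).

Definition circuit (C : {set T}) :=
  minset [pred X : {set T} | (X \subset E) && ~~ indep X] C.

Definition lambda (X : {set T}) := r X + r (E :\: X) - r E.

Definition separation (k : nat) (X : {set T}) :=
  [/\ X \subset E, lambda X < k, k <= #|X| & k <= #|E :\: X|].

Definition connected (n : nat) :=
  forall (k : nat) (X : {set T}), 0 < k -> k < n -> ~ separation k X.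

Definition loop (x : T) := circuit [set x].

(* An equivalence relation on the non-loop elements only. *)
Definition parallel (x y : T) := (x == y) || circuit [set x; y].

Definition nonloops := [set x in E | ~~ loop x].

Definition parallel_classes := equivalence_partition parallel nonloops.

(* [transversal] selects one element from each parallel class; another choice
   of representatives would give an isomorphic matroid. *)
Definition si : matroid T :=
  delete M (E :\: transversal parallel_classes nonloops).

End Notions.

Definition co (T : finType) (M : matroid T) : matroid T := dual (si (dual M)).

Definition cocircuit (T : finType) (M : matroid T) (X : {set T}) :=
  circuit (dual M) X.

Definition triangle (T : finType) (M : matroid T) (X : {set T}) :=
  circuit M X && (#|X| == 3).

Definition triad (T : finType) (M : matroid T) (X : {set T}) :=
  cocircuit M X && (#|X| == 3).

Definition fan4 (T : finType) (M : matroid T) (x1 x2 x3 x4 : T) :=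
  [/\ uniq [:: x1; x2; x3; x4],
      triangle M [set x1; x2; x3] & triad M [set x2; x3; x4]].

Definition isomorphic (T T' : finType) (M : matroid T) (N : matroid T') :=
  exists f : {x : T | x \in ground M} -> T',
    [/\ injective f, [set f x | x in [set: {x : T | x \in ground M}]] = ground N
      & forall X : {set {x : T | x \in ground M}},
          rk N [set f x | x in X] = rk M [set val x | x in X]].

Definition has_minor (T T' : finType) (M : matroid T) (N : matroid T') :=
  exists C D : {set T},
    [/\ C \subset ground M, D \subset ground M, [disjoint C & D]
      & isomorphic (delete (contract M C) D) N].

(* Main.v *)
(* Dualize, so that C is a cocircuit (only used: its complement is a flat) and
   elements are contracted.  If si (M / x) is not 3-connected then M has a
   vertical 3-separation (X, x, Y): sets of rank at least 3 with
   r X + r Y = r M + 2 and x in both closures.  An N-minor of M / x has at most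
   one element in X, say, and then every element of X outside the closure of Y
   can be contracted keeping an N-minor.  Choose such a separation, over all x
   in C, with |X| minimal; X meets C in some e, and we may assume that M has a
   vertical 3-separation at e.  Uncrossing it with (X, x, Y) gives r X = 3, so X
   is a cocircuit, and the plane spanned by X is covered by two lines through e.
   Let L be the one through x.  If M has no vertical 3-separation at the points
   of L other than e and x, then X is a triad and a fan appears.  Otherwise the
   plane is L with one more point h, and M has vertical 3-separations at two
   points e, f of L.  Uncrossing these two forces, besides h and x, points b, a
   such that L - e with b and L - f with a contain cocircuits, and this rules
   out every 2-separation of si (M / x) other than the series pairs. *)

Require Import Defs.
From mathcomp Require Import all_boot zify.

Set Implicit Arguments.
Unset Strict Implicit.
Unset Printing Implicit Defensive.

(** Two vertical 3-separations can be uncrossed because both are small for one and the same copy of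
    N. Contracting e in X may move the copy, but it keeps at most one element in X, and the side A
    of the separation at e is chosen for the new copy. As N has at least four elements, two of them
    avoid both X and A, which is the room that uncrossing needs. Hence a minor is carried as a
    contracted set with an embedding, and the induction on |X| lets both vary.

    The cocircuit C enters through orthogonality: a line through a point of C cannot have two points
    off C, and x in the closure of X forces X to meet C.

    Outcome (ii) is needed because si (M / x) can retain a series pair, formed by h and the point to
    which L - x collapses; simplifying the dual once more removes it. *)

(** * Pointwise automation for sets, and arithmetic on ranks *)

Lemma set_eq_imp (T : finType) (A B : {set T}) : A = B ->
  forall z, ((z \in A) ==> (z \in B)) && ((z \in B) ==> (z \in A)).
Proof. by move=> -> z; rewrite implybb. Qed.

(* Locked so that [inE] leaves membership in a closure alone. *)
Definition mclosure (T : finType) (M : matroid T) (X : {set T}) : {set T} :=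
  locked [set e | rk M (e |: X) == rk M X].

Ltac subset_facts z :=
  repeat match goal with
  | H : is_true (?A \subset ?B) |- _ => move/implyP: (subsetP H z); clear H
  | H : ?A = ?B |- _ => move: (set_eq_imp H z); clear H
  end.

Ltac mem_facts :=
  repeat match goal with
  | H : is_true (_ \in mclosure _ _) |- _ => clear H
  | H : is_true (_ \notin mclosure _ _) |- _ => clear H
  | H : is_true (?x \in ?A) |- _ => move: (H); clear H
  | H : is_true (?x \notin ?A) |- _ => move: (H); clear H
  | H : is_true (?x != ?y) |- _ => move: (H); clear H
  end.

Ltac case_eq_at x y :=
  let h := fresh in
  case: (eqVneq x y) => [h|_]; [rewrite ?h; clear h|]; rewrite ?eqxx //=.

Ltac set_cases z :=
  clear - z; rewrite ?inE ?eqxx //=;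
  repeat match goal with
  | |- context [z == ?e] => case_eq_at z e
  end;
  repeat match goal with
  | |- context [?x \in ?A] => case: (x \in A) => //=
  end;
  repeat match goal with
  | |- context [?x == ?y] => case_eq_at x y
  end.

Ltac use_mem :=
  repeat match goal with
  | H : is_true (?x \in ?A) |- context [?x \in ?A] => rewrite H /=
  | H : is_true (?x \notin ?A) |- context [?x \in ?A] => rewrite (negbTE H) /=
  | H : is_true (?x != ?y) |- context [?x == ?y] => rewrite (negbTE H) /=
  | H : is_true (?x != ?y) |- context [?y == ?x] =>
      rewrite (eq_sym y x) (negbTE H) /=
  end.

Ltac set_cases_mem z :=
  rewrite ?inE ?eqxx //=;
  repeat match goal with
  | |- context [z == ?e] => case_eq_at z e
  end; use_mem;
  repeat match goal with
  | |- context [?x \in ?A] => case: (x \in A) => //=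
  end.

(** The first variant rewrites with the membership facts of the context; the second turns them into
    premises and also splits on equalities between elements. *)
Ltac set_solve z :=
  first [ by subset_facts z; set_cases_mem z
        | by subset_facts z; mem_facts; set_cases z ].

Ltac sset :=
  match goal with
  | |- is_true (_ \subset _) =>
      let z := fresh "z" in apply/subsetP=> z; apply/implyP; set_solve z
  | |- _ = _ => let z := fresh "z" in apply/setP=> z; set_solve z
  | |- is_true (?z \in _) => set_solve z
  | |- is_true (?z \notin _) => set_solve z
  end.

Ltac rlia :=
  move=> *;
  repeat match goal with
  | H : is_true (_ \subset _) |- _ => clear H
  | H : is_true (_ \in _) |- _ => clear H
  | H : is_true (_ \notin _) |- _ => clear H
  | H : is_true (_ != _) |- _ => clear H
  | H : is_true (minset _ _) |- _ => clear H
  | H : is_true (maxset _ _) |- _ => clear H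
  end; lia.

(** * Rank and closure *)

Section Rank.
Variables (T : finType) (M : matroid T).
Local Notation E := (ground M).
Local Notation r := (rk M).
Local Notation cl := (mclosure M).
Implicit Types (A B X Y Z : {set T}) (a b e f x : T).

Lemma rk0 : r set0 = 0.
Proof. by apply/eqP; rewrite -leqn0 -(cards0 T) rk_card. Qed.

Lemma rkU1 e X : r (e |: X) <= (r X).+1.
Proof.
have := rk_submod M [set e] X; have := rk_card M [set e]; rewrite cards1; lia.
Qed.

Lemma rkU X Y : r (X :|: Y) <= r X + r Y.
Proof. by have := rk_submod M X Y; lia. Qed.

(** Submodularity weakened by monotonicity, so that union and intersection need only be estimated by
    inclusion. Most rank arguments below choose instances of this inequality and leave the
    arithmetic to [lia]. *)
Lemma rk_sub A B X Y : A \subset X :|: Y -> B \subset X :&: Y ->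
  r A + r B <= r X + r Y.
Proof.
move=> sA sB; have := rk_submod M X Y; have := rk_mono M sA; have := rk_mono M sB.
lia.
Qed.

Lemma rk_groundS X : E \subset X -> r X = r E.
Proof. by move=> /setIidPr eX; rewrite rk_ground eX. Qed.

Lemma rk_leE X : r X <= r E.
Proof. by rewrite rk_ground rk_mono // subsetIr. Qed.

Lemma clP e X : reflect (r (e |: X) = r X) (e \in cl X).
Proof. by rewrite /mclosure -lock inE; apply: eqP. Qed.

Lemma notclP e X : e \notin cl X -> r (e |: X) = (r X).+1.
Proof.
rewrite /mclosure -lock inE => h; have := rkU1 e X; have := rk_mono M (subsetUr [set e] X).
move/eqP: h; lia.
Qed.

Lemma sub_cl X : X \subset cl X.
Proof.
by apply/subsetP => e eX; apply/clP; congr r; apply/setUidPr; rewrite sub1set.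
Qed.

Lemma mem_cl e X : e \in X -> e \in cl X.
Proof. exact: subsetP (sub_cl X) e. Qed.

Lemma clS X Y : X \subset Y -> cl X \subset cl Y.
Proof.
move=> sXY; apply/subsetP => e /clP h; apply/clP.
have h1 := @rk_sub (e |: Y) X (e |: X) Y.
have : r (e |: Y) + r X <= r (e |: X) + r Y.
  by apply: h1; rewrite -?setUA ?setUS ?subsetUr // subsetI subsetUr.
have := rk_mono M (subsetUr [set e] Y); lia.
Qed.

Lemma rkU_cl X A : A \subset cl X -> r (A :|: X) = r X.
Proof.
move: {2}#|A| (leqnn #|A|) => n; elim: n A => [|n IH] A cA sA.
  by move: cA; rewrite leqn0 cards_eq0 => /eqP ->; rewrite set0U.
have [->|/set0Pn [a aA]] := eqVneq A set0; first by rewrite set0U.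
have cA' : #|A :\ a| <= n by have := cardsD1 a A; rewrite aA; lia.
have sA' : A :\ a \subset cl X by apply: subset_trans sA; apply: subsetDl.
have -> : A :|: X = a |: (A :\ a :|: X) by rewrite setUA setD1K.
rewrite -(IH _ cA' sA'); apply/clP.
by apply: (subsetP (clS (subsetUr (A :\ a) X))); apply: (subsetP sA).
Qed.

Lemma rk_cl X : r (cl X) = r X.
Proof. by rewrite -(@rkU_cl X (cl X)) // (setUidPl (sub_cl X)). Qed.

Lemma cl_min X Y : X \subset cl Y -> cl X \subset cl Y.
Proof.
move=> h; apply: subset_trans (clS h) _; apply/subsetP=> e /clP he; apply/clP.
have := @rk_mono _ M (e |: Y) (e |: cl Y); rewrite he rk_cl.
rewrite setUS ?sub_cl // => /(_ isT); have := rk_mono M (subsetUr [set e] Y); lia.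
Qed.

Lemma rk_eq_cl X Y : X \subset Y -> r Y <= r X -> Y \subset cl X.
Proof.
move=> sXY h; apply/subsetP=> e eY; apply/clP.
have := rk_mono M (subsetUr [set e] X).
have : r (e |: X) <= r Y by apply: rk_mono; sset.
lia.
Qed.

Lemma cl_exch e f X : e \in cl (f |: X) -> e \notin cl X -> f \in cl (e |: X).
Proof.
move=> /clP h1 /notclP h2; apply/clP; have := rkU1 f X.
have -> : f |: (e |: X) = e |: (f |: X) by sset.
rewrite h1 h2; have : r (e |: X) <= r (f |: X) by rewrite -h1; apply: rk_mono; sset.
lia.
Qed.

End Rank.

Ltac submod M A B X Y :=
  have : rk M A + rk M B <= rk M X + rk M Y by apply: rk_sub; sset.

Ltac rkmono M X Y := have : rk M X <= rk M Y by apply: rk_mono; sset.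

(** * 3-connectedness as lower bounds on ranks *)

Section Conn.
Variables (T : finType) (M : matroid T).
Local Notation E := (ground M).
Local Notation r := (rk M).
Implicit Types (A B X Y Z : {set T}) (a b e f x : T).
Hypothesis M3 : connected M 3.

(** A cover contains a partition, here [E :\: Y] and its complement, and ranks grow with the sets.
    Overlapping sets are allowed because uncrossing and closures produce them. *)
Lemma conn2 X Y : E \subset X :|: Y -> 1 < #|E :\: Y| -> 1 < #|E :\: X| ->
  (r E).+2 <= r X + r Y.
Proof.
move=> sE cY cX; have h := M3 (k := 2) (X := E :\: Y) isT isT.
rewrite leqNgt; apply/negP => lt; apply: h; split=> //; first exact: subsetDl.
- have h1 : r (E :\: Y) <= r X by apply: rk_mono; sset.
  have h2 : r (E :\: (E :\: Y)) <= r Y by apply: rk_mono; sset.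
  rewrite /lambda; lia.
- by apply: leq_trans cX (subset_leq_card _); sset.
Qed.

Lemma conn1 X Y : E \subset X :|: Y -> 0 < #|E :\: Y| -> 0 < #|E :\: X| ->
  (r E).+1 <= r X + r Y.
Proof.
move=> sE cY cX; have h := M3 (k := 1) (X := E :\: Y) isT isT.
rewrite leqNgt; apply/negP => lt; apply: h; split=> //; first exact: subsetDl.
- have h1 : r (E :\: Y) <= r X by apply: rk_mono; sset.
  have h2 : r (E :\: (E :\: Y)) <= r Y by apply: rk_mono; sset.
  rewrite /lambda; lia.
- by apply: leq_trans cX (subset_leq_card _); sset.
Qed.
End Conn.

(** * Minors, and the small side of a 2-separation *)

Section Minors.
Variables (T T' : finType) (K : matroid T) (N : matroid T').
Local Notation E := (ground K).
Local Notation r := (rk K).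
Local Notation F := (ground N).
Implicit Types (A B X Y Z C D : {set T}) (a b e f x : T) (g : T' -> T).

(* [g] embeds [N] as the restriction of [K / C] to its image; the deleted set is
   left implicit. *)
Definition minor_via C g :=
  [/\ C \subset E, {in F &, injective g}, g @: F \subset E :\: C
    & forall Z : {set T'}, Z \subset F -> rk N Z + r C = r (g @: Z :|: C)].

(** Taking minors does not raise connectivity: with two elements of [N] on each side, the trace of
    [X] would be a 2-separation of [N]. *)
Lemma minor_via_small_side X C g : connected N 3 -> minor_via C g -> X \subset E ->
  r X + r (E :\: X) <= (r E).+1 ->
  #|g @: F :&: X| <= 1 \/ #|g @: F :&: (E :\: X)| <= 1.
Proof.
move=> N3 [sCE ginj sgE rg] sXE hr; set Y := E :\: X.
pose Z := [set y in F | g y \in X]; pose W := F :\: Z.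
have sZF : Z \subset F by rewrite /Z; sset.
have sWF : W \subset F by rewrite /W; sset.
have card_im (V : {set T'}) : V \subset F -> #|g @: V| = #|V|.
  move=> sVF; apply: card_in_imset => u v uV vV.
  by apply: ginj; apply: (subsetP sVF).
have gZ : g @: F :&: X = g @: Z.
  apply/setP=> z; rewrite inE; apply/andP/imsetP.
    by move=> [/imsetP [y yF ->] zX]; exists y; rewrite // inE yF.
  move=> [y]; rewrite inE => /andP [yF yX] ->; split=> //; exact: imset_f.
have gW : g @: F :&: Y = g @: W.
  apply/setP=> z; rewrite inE; apply/andP/imsetP.
    move=> [/imsetP [y yF ->]]; rewrite inE => /andP [h _]; exists y => //.
    by rewrite !inE yF (negbTE h).
  move=> [y]; rewrite !inE => /andP [h yF] ->; split; first exact: imset_f.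
  have := subsetP sgE (g y) (imset_f g yF); rewrite inE => /andP [_ ->].
  by rewrite yF /= in h; rewrite h.
rewrite gZ gW !card_im //.
case: (leqP #|Z| 1) => cZ; first by left.
case: (leqP #|W| 1) => cW; first by right.
have h : (rk N F).+2 <= rk N Z + rk N W.
  by apply: conn2 => //; [|apply: leq_trans cZ (subset_leq_card _)]; rewrite /W; sset.
exfalso; move: h.
have := rg Z sZF; have := rg W sWF; have := rg F (subxx _).
have sgZ : g @: Z \subset X by rewrite -gZ subsetIr.
have sgW : g @: W \subset Y by rewrite -gW subsetIr.
have -> : g @: F = g @: Z :|: g @: W.
  by rewrite -imsetU; have -> : Z :|: W = F by rewrite /W; sset.
move: (g @: Z) (g @: W) sgZ sgW => P Q sP sQ h1 h2 h3.
have eY : Y = E :\: X by []. rewrite -eY in hr.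
(* The first two instances pass from [X] and [Y] to [P] and [Q]; the other three account for the
   contraction of [C]. *)
submod K (X :|: Y) (P :|: C) (X :|: C) (P :|: C :|: Y).
submod K (P :|: C :|: Y) (Q :|: C) (P :|: Q :|: C) (Y :|: C).
submod K (X :|: C) (C :&: X) X C.
submod K (Y :|: C) (C :&: Y) Y C.
submod K C (@set0 T) (C :&: X) (C :&: Y).
have : r (X :|: Y) = r E by apply: rk_groundS; sset.
rewrite rk0.
move=> *; rlia.
Qed.

Section SmallSide.
Variables (X : {set T}) (e : T).
Let Y := E :\: X.
Hypotheses (sXE : X \subset E) (hr : r X + r Y = (r E).+1).

Lemma skew_sub D Z : Z \subset Y -> r (Y :|: D) = r Y + r D ->
  r (Z :|: D) = r Z + r D.
Proof.
move=> sZ; submod K (Y :|: D) Z Y (Z :|: D); have := rkU K Z D; rlia.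
Qed.

(** By [hr] the local connectivity between [Y] and a subset of [X] is 0 or 1. A set [D] reaching 1
    already captures all the interaction, so contracting [D] has the same effect on [Y] as
    contracting [X]. *)
Lemma nonskew_sub D Z : Z \subset Y -> D \subset X -> r (Y :|: D) < r Y + r D ->
  r (Z :|: D) + r X = r D + r (Z :|: X).
Proof.
move=> sZ sD; submod K (Z :|: X) D (Z :|: D) X.
have eY : Y = E :\: X by [].
submod K (ground K) (Z :|: D) (Z :|: X) (Y :|: D).
move: hr; rlia.
Qed.

Lemma nonskewS C D : C \subset D -> r (Y :|: C) < r Y + r C ->
  r (Y :|: D) < r Y + r D.
Proof.
move=> sC; submod K (Y :|: D) C (Y :|: C) D; rlia.
Qed.

Hypotheses (eX : e \in X) (eY : e \notin mclosure K Y).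

(** [I] is a maximal subset of [X] through [e] that is independent modulo [Y]; [eY] allows starting
    from [[set e]]. By [hr] it is one element short of a basis of [X], which [p] completes. On [Y],
    contracting [I] acts as deletion, and contracting [p |: I] acts as contracting [X]. *)
Lemma small_side_basis : exists (I : {set T}) p,
  [/\ I \subset X, e \in I, p \in X & p \notin I] /\
  [/\ (#|I|).+1 = r X, forall Z : {set T}, Z \subset Y -> r (Z :|: I) = r Z + #|I|
    & forall Z : {set T}, Z \subset Y -> r (Z :|: (p |: I)) = r (Z :|: X)].
Proof.
have dY : Y = E :\: X by [].
pose P := [pred I : {set T} | [&& I \subset X, e \in I & r (Y :|: I) == r Y + #|I|]].
have P1 : P [set e].
  rewrite /= sub1set eX set11 cards1 setUC; apply/eqP; rewrite (notclP eY); rlia.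
have [I maxI _] := @maxset_exists _ P _ P1.
have [/and3P [sI eI /eqP rI] maxI'] := maxsetP maxI.
have sXc : X \subset mclosure K (Y :|: I).
  apply/subsetP=> f fX; apply/negPn/negP => /notclP nf.
  have fI : f \notin I.
    apply/negP=> fI; move: nf; have -> : f |: (Y :|: I) = Y :|: I by sset.
    rlia.
  suff : f \in I by rewrite (negbTE fI).
  rewrite -(maxI' (f |: I)) ?setU11 ?subsetUr //.
  rewrite /= !inE eI orbT /= cardsU1 fI.
  have -> : Y :|: (f |: I) = f |: (Y :|: I) by sset.
  rewrite nf rI; apply/andP; split; [sset | apply/eqP; lia].
have rE : r E = r Y + #|I|.
  rewrite -rI -(rkU_cl sXc); apply/esym/rk_groundS; sset.
have rIc : r I = #|I|.
  have := rk_card K I; have := rkU K Y I; rlia.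
have cI : (#|I|).+1 = r X by move: hr; rlia.
have [p pX pI] : exists2 p, p \in X & p \notin mclosure K I.
  apply/subsetPn/negP => h; have := rkU_cl h.
  rkmono K X (X :|: I); rlia.
exists I, p; split; [split=> //|split=> //].
- by apply: contra pI; apply: mem_cl.
- by move=> Z sZ; rewrite -rIc; apply: skew_sub => //; rewrite rIc.
move=> Z sZ; apply/eqP; rewrite eqn_leq; apply/andP; split.
  by apply: rk_mono; sset.
have h : X \subset mclosure K (p |: I).
  apply: rk_eq_cl; first by sset.
  by rewrite (notclP pI) rIc cI.
have := rkU_cl (subset_trans h (clS K (subsetUr Z (p |: I)))).
rkmono K (Z :|: X) (X :|: (Z :|: (p |: I))); rlia.
Qed.

(** The rank hypothesis says that contracting [D] and contracting [C :&: X] induce the same matroid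
    on [Y]. When [N] lies inside [Y], one may therefore replace the other. *)
Lemma minor_via_swap C D g : minor_via C g -> g @: F \subset Y -> D \subset X ->
  (forall Z, Z \subset Y -> r (Z :|: D) + r (C :&: X) = r (Z :|: C :&: X) + r D) ->
  minor_via (D :|: C :&: Y) g.
Proof.
move=> [sC gi gE rg] sgY sD hD; have dY : Y = E :\: X by [].
split=> //; [sset | sset |].
move=> Z sZ; have := rg Z sZ; have sgZ := subset_trans (imsetS g sZ) sgY.
have := hD (g @: Z :|: C :&: Y) ltac:(sset).
have := hD (C :&: Y) ltac:(sset).
have -> : g @: Z :|: (D :|: C :&: Y) = g @: Z :|: C :&: Y :|: D by sset.
have -> : g @: Z :|: C :&: Y :|: C :&: X = g @: Z :|: C by sset.
have -> : C :&: Y :|: C :&: X = C by sset.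
rewrite (setUC (C :&: Y) D); rlia.
Qed.

(* With at most one element of N in the small side X of an exact 2-separation,
   N only sees X through one point p of the guts, so any choice of a basis of X
   through e, with the last element playing the role of p, yields N again. *)
Lemma minor_via_contract C g : connected N 3 -> 1 < #|F| -> minor_via C g ->
  #|g @: F :&: X| <= 1 ->
  exists C2 g2, [/\ minor_via C2 g2, e \in C2 & #|g2 @: F :&: X| <= 1].
Proof.
move=> N3 cF wCg; have [sC gi gE rg] := wCg => cX.
have dY : Y = E :\: X by [].
have [I [p [[sI eI pX pI] [cI rI rpI]]]] := small_side_basis.
have rI0 : r I = #|I|.
  by have := rI set0 (sub0set _); rewrite set0U rk0.
have rpI0 : r (p |: I) = r X.
  by have := rpI set0 (sub0set _); rewrite !set0U.
have sCX : C :&: X \subset X by apply: subsetIr.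
have dich D : r (Y :|: D) = r Y + r D \/ r (Y :|: D) < r Y + r D.
  have := rkU K Y D; rlia.
have [g0|/set0Pn [s]] := eqVneq (g @: F :&: X) set0.
  have sgY : g @: F \subset Y.
    apply/subsetP=> z zg; rewrite inE; apply/andP; split.
      by apply: contraT => /negPn zX; have := in_set0 z; rewrite -g0 inE zg zX.
    by have := subsetP gE z zg; rewrite inE => /andP [].
  (* [C :&: X] acts on [Y] either as a deletion or as the whole of [X]; [I] reproduces the first
     effect and [p |: I] the second. *)
  have [sk|nsk] := dich (C :&: X).
    exists (I :|: C :&: Y), g; rewrite g0 cards0; split=> //; last by sset.
    apply: minor_via_swap => // Z sZ; rewrite (skew_sub sZ sk) rI // rI0; rlia.
  exists ((p |: I) :|: C :&: Y), g; rewrite g0 cards0; split=> //; last by sset.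
  apply: minor_via_swap => //; first by sset.
  move=> Z sZ; have := nonskew_sub sZ sCX nsk; rewrite rpI // rpI0; rlia.
rewrite inE => /andP [/imsetP [y0 y0F ->]] sX {s}.
pose F' := F :\ y0.
have sgF' : g @: F' \subset Y.
  apply/subsetP=> _ /imsetP [y yF' ->]; move: (yF'); rewrite !inE => /andP [yy0 yF].
  apply/andP; split; last by have := subsetP gE (g y) (imset_f g yF); rewrite inE => /andP [].
  apply/negP => gyX; have h : [set g y; g y0] \subset g @: F :&: X.
    by apply/subsetP=> z; rewrite !inE => /orP [/eqP ->|/eqP ->]; rewrite imset_f.
  have := leq_trans (subset_leq_card h) cX; rewrite cards2.
  case: eqP => // /gi e0; move: yy0; rewrite e0 ?eqxx //.
set s := g y0 in sX.
have sgF'C : g @: F' \subset E :\: C.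
  by apply: subset_trans gE; apply/imsetS/subsetDl.
have gU (h : T' -> T) (Z : {set T'}) : y0 \in Z -> h @: Z = h y0 |: h @: (Z :\ y0).
  by move=> y0Z; rewrite -imsetU1 setD1K.
have sE : s \in E :\: C by apply: (subsetP gE); apply: imset_f.
have eF' : F = y0 |: F' by rewrite setD1K.
(* [y0] is neither a loop nor a coloop of [N]. Hence [s |: C :&: X] is not skew to [Y] while
   [C :&: X] is: in the other cases [s] would add the same rank with and without the rest of [N]. *)
have rNF : (rk N F).+1 <= rk N F' + rk N [set y0].
  apply: conn1 => //; first by rewrite {1}eF'; sset.
    rewrite /F'; have := cardsD1 y0 F; rewrite y0F.
    rlia.
  by rewrite card_gt0; apply/set0Pn; exists y0; rewrite !inE eqxx.
have := rg _ (subxx F); have := rg F' ltac:(rewrite /F'; sset).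
have := rg [set y0] ltac:(sset).
rewrite imset_set1 -/s (gU g F) // -/s -/F'.
have -> : s |: g @: F' :|: C = (g @: F' :|: C :&: Y) :|: (s |: C :&: X) by sset.
have -> : g @: F' :|: C = (g @: F' :|: C :&: Y) :|: C :&: X by sset.
have -> : s |: C = C :&: Y :|: (s |: C :&: X) by sset.
have eC : C = C :&: Y :|: C :&: X by sset.
have eC' : r C = r (C :&: Y :|: C :&: X) by rewrite {1}eC.
move=> n1 n2 n3.
have sW1 : g @: F' :|: C :&: Y \subset Y by sset.
have sW2 : C :&: Y \subset Y by sset.
have ssX : s |: C :&: X \subset X by sset.
have [nsk|sk] : r (Y :|: (s |: C :&: X)) < r Y + r (s |: C :&: X) \/
  r (Y :|: (s |: C :&: X)) = r Y + r (s |: C :&: X) by case: (dich (s |: C :&: X)); auto.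
  have [sk'|nsk'] := dich (C :&: X); last first.
    have := nonskew_sub sW1 ssX nsk; have := nonskew_sub sW2 ssX nsk.
    have := nonskew_sub sW1 sCX nsk'; have := nonskew_sub sW2 sCX nsk'.
    rlia.
  have rs : r (s |: C :&: X) = (r (C :&: X)).+1.
    have := rkU1 K s (C :&: X).
    rkmono K (Y :|: C :&: X) (Y :|: (s |: C :&: X)); rlia.
  pose g2 y := if y == y0 then p else g y.
  have g2E (Z : {set T'}) : y0 \notin Z -> g2 @: Z = g @: Z.
    move=> yZ; apply: eq_in_imset => y yyZ; rewrite /g2.
    by case: eqP => // yy; move: yZ; rewrite -yy yyZ.
  have g2y0 : g2 y0 = p by rewrite /g2 eqxx.
  have g2F : g2 @: F = p |: g @: F'.
    by rewrite (gU g2) // g2y0 g2E // !inE eqxx.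
  exists (I :|: C :&: Y), g2; split; last 2 first.
  - by sset.
  - have : g2 @: F :&: X \subset [set p] by rewrite g2F; sset.
    by move=> /subset_leq_card; rewrite cards1.
  have pF' y : y \in F' -> g y <> p.
    move=> /(imset_f g) /(subsetP sgF'); rewrite inE => /andP [h _] ep.
    by rewrite ep pX in h.
  split; [sset | | rewrite g2F; sset |].
  - move=> u v uF vF; rewrite /g2.
    case: (eqVneq u y0) => [->|nu]; case: (eqVneq v y0) => [->|nv] //.
    + by move=> ep; case: (@pF' v) => //; rewrite !inE nv.
    + by move=> ep; case: (@pF' u) => //; rewrite !inE nu.
    + exact: gi.
  move=> Z sZ; have := rg Z sZ.
  have rIC : r (I :|: C :&: Y) = r (C :&: Y) + #|I| by rewrite setUC rI.
  have rC : r C = r (C :&: Y) + r (C :&: X) by rewrite {1}eC (skew_sub sW2 sk').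
  case: (boolP (y0 \in Z)) => yZ; last first.
    have sgZ : g @: Z \subset Y.
      apply: subset_trans sgF'; apply: imsetS; apply/subsetP => y yyZ.
      by rewrite !inE (subsetP sZ) // andbT; apply: contraNneq yZ => <-.
    have sW : g @: Z :|: C :&: Y \subset Y by sset.
    rewrite g2E //.
    have -> : g @: Z :|: C = (g @: Z :|: C :&: Y) :|: C :&: X by sset.
    have -> : g @: Z :|: (I :|: C :&: Y) = (g @: Z :|: C :&: Y) :|: I by sset.
    rewrite (skew_sub sW sk') (rI _ sW); rlia.
  have sgZ : g @: (Z :\ y0) \subset Y.
    by apply: subset_trans sgF'; apply: imsetS; apply: setSD.
  have sW : g @: (Z :\ y0) :|: C :&: Y \subset Y by sset.
  rewrite (gU g Z) // (gU g2 Z) // g2y0 -/s g2E ?inE ?eqxx //.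
  move: (g @: (Z :\ y0)) sgZ sW => P sgZ sW.
  have -> : s |: P :|: C = (P :|: C :&: Y) :|: (s |: C :&: X) by sset.
  have -> : p |: P :|: (I :|: C :&: Y) = (P :|: C :&: Y) :|: (p |: I) by sset.
  rewrite (rpI _ sW); have := nonskew_sub sW ssX nsk; rlia.
have := skew_sub sW1 sk; have := skew_sub sW2 sk.
have rr := rkU1 K s (C :&: X).
case: (dich (C :&: X)) => [sk'|/(nonskewS (subsetUr [set s] _))]; last by rlia.
have := skew_sub sW1 sk'; have := skew_sub sW2 sk'; rlia.
Qed.
End SmallSide.
End Minors.

Lemma minor_via_contractP (T T' : finType) (M : matroid T) (N : matroid T') x (C : {set T}) (g : T' -> T) :
  x \in ground M -> x \in C ->
  minor_via M N C g <-> minor_via (contract M [set x]) N (C :\ x) g.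
Proof.
move=> xE xC; have eC : C = x |: (C :\ x) by rewrite setD1K.
have le (Z : {set T}) : rk M [set x] <= rk M (Z :|: [set x]) by apply: rk_mono; apply: subsetUr.
have rC : rk (contract M [set x]) (C :\ x) + rk M [set x] = rk M C.
  by rewrite /= /con_rk subnK // setUC setD1K.
have rZ (Z : {set T'}) :
  rk (contract M [set x]) (g @: Z :|: C :\ x) + rk M [set x] = rk M (g @: Z :|: C).
  by rewrite /= /con_rk subnK // -setUA [_ :\ _ :|: _]setUC setD1K.
split=> -[sC gi gE rg]; split=> //.
- by rewrite /=; sset.
- by apply: subset_trans gE _; rewrite /=; sset.
- by move=> Z sZ; have := rg Z sZ; have := rZ Z; rlia.
- by move: sC; rewrite eC /=; move=> sC; sset.
- by apply: subset_trans gE _; rewrite /=; sset.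
by move=> Z sZ; have := rg Z sZ; have := rZ Z; rlia.
Qed.

(** * Vertical 3-separations and their uncrossing *)

Section Vertical.
Variables (T : finType) (M : matroid T).
Local Notation E := (ground M).
Local Notation r := (rk M).
Local Notation cl := (mclosure M).
Implicit Types (A B C X Y Z L R : {set T}) (a b e f x : T).
Hypotheses (M3 : connected M 3) (cE : 3 < #|E|).

(** The sides are bounded in rank and not in size: each must keep rank 2 after [x] is contracted, so
    that it survives the collapse of parallel classes. *)
Definition vsep x X := [&& x \in E, X \subset E :\ x, 2 < r X,
  2 < r (E :\ x :\: X), r X + r (E :\ x :\: X) == (r E).+2,
  x \in cl X & x \in cl (E :\ x :\: X)].

Definition vsep_point x := [exists X, vsep x X].

Lemma vsepP x X : reflect ([/\ x \in E, X \subset E & x \notin X] /\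
  [/\ 2 < r X, 2 < r (E :\ x :\: X), r X + r (E :\ x :\: X) = (r E).+2,
  x \in cl X & x \in cl (E :\ x :\: X)]) (vsep x X).
Proof.
apply: (iffP idP) => [/and5P [xE sX rX rY /andP [/eqP h /andP [xX xY]]]|].
  by do !split=> //; sset.
move=> [[xE sX xX] [rX rY h clX clY]]; rewrite /vsep xE rX rY h eqxx clX clY !andbT /=.
by sset.
Qed.

Lemma vsep_sym x X : vsep x X -> vsep x (E :\ x :\: X).
Proof.
move=> /vsepP [[xE sX xX] [rX rY h clX clY]].
have e : E :\ x :\: (E :\ x :\: X) = X by sset.
apply/vsepP; rewrite e addnC; do !split=> //; sset.
Qed.

Lemma card_rk k X : k < r X -> k < #|X|.
Proof. by move=> h; apply: leq_trans h (rk_card _ _). Qed.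

Lemma card_ge2 a b X : a != b -> a \in X -> b \in X -> 1 < #|X|.
Proof.
move=> ab aX bX; have : #|[set a; b]| = 2 by rewrite cards2 ab.
move=> <-; apply: subset_leq_card; sset.
Qed.

Lemma rk1E e : e \in E -> r [set e] = 1.
Proof.
move=> eE; have := rk_card M [set e]; rewrite cards1.
have : (r E).+1 <= r [set e] + r (E :\ e).
  apply: conn1 => //; first by sset.
    by rewrite card_gt0; apply/set0Pn; exists e; rewrite !inE eE eqxx.
  by have := cardsD1 e E; rewrite eE; rlia.
have := rk_leE M (E :\ e); rlia.
Qed.

Lemma rk2E a b : a \in E -> b \in E -> a != b -> r [set a; b] = 2.
Proof.
move=> aE bE ab; have := rk_card M [set a; b]; rewrite cards2 ab.
have : (r E).+2 <= r [set a; b] + r (E :\: [set a; b]).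
  apply: conn2 => //; first by sset.
    by apply: (@card_ge2 a b) => //; sset.
  have := cardsID [set a; b] E.
  have -> : E :&: [set a; b] = [set a; b] by sset.
  by rewrite cards2 ab; rlia.
have := rk_leE M (E :\: [set a; b]); rlia.
Qed.

Lemma line_cl a b L : a \in L -> b \in L -> a != b -> L \subset E -> r L <= 2 ->
  L \subset cl [set a; b].
Proof.
move=> aL bL ab sL rL; apply: rk_eq_cl; first by sset.
by rewrite rk2E //; sset.
Qed.

(** Moving points of [cl Y] over to [Y] does not change [r Y], and 3-connectedness then prevents the
    rank of the remaining side from dropping. A smallest [X] is therefore disjoint from [cl Y]. *)
Lemma vsep_trim x X : vsep x X -> vsep x (X :\: cl (E :\ x :\: X)).
Proof.
move=> /vsepP []; set Y := E :\ x :\: X => -[xE sX xX] [rX rY h clX clY].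
have dY : Y = E :\ x :\: X by [].
set X' := X :\: cl Y; have dX' : X' = X :\: cl Y by [].
have sY : Y \subset cl Y := sub_cl M Y.
have eY' : r (E :\ x :\: X') = r Y.
  rkmono M Y (E :\ x :\: X'); rkmono M (E :\ x :\: X') (cl Y).
  rewrite rk_cl; rlia.
have rxY : r (x |: (E :\ x :\: X')) = r Y.
  rkmono M Y (x |: (E :\ x :\: X')); rkmono M (x |: (E :\ x :\: X')) (cl Y).
  rewrite rk_cl; rlia.
have le : r X' <= r X by apply: rk_mono; sset.
have c3 : 2 < #|E :\: X'|.
  by apply: leq_trans (card_rk rY) (subset_leq_card _); sset.
have eX' : X' = E :\: (x |: (E :\ x :\: X')) by sset.
have rX' : r X' = r X.
  case: (posnP #|X'|) => [/eqP|c0].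
    rewrite cards_eq0 => /eqP X0.
    have : r E <= r (x |: (E :\ x :\: X')) by apply: rk_mono; sset.
    rlia.
  have h1 : (r E).+1 <= r X' + r (x |: (E :\ x :\: X')).
    by apply: conn1 => //; [sset | rewrite -eX' | rlia].
  have [c1|c1] := leqP #|X'| 1; first by have := rk_card M X'; rlia.
  have h2 : (r E).+2 <= r X' + r (x |: (E :\ x :\: X')).
    by apply: conn2 => //; [sset | rewrite -eX' | rlia].
  rlia.
apply/vsepP; rewrite -/X' rX' eY'; do !split=> //; [sset | sset | |].
  have sXX' : X \subset cl X' by apply: rk_eq_cl; [sset | rlia].
  exact: (subsetP (cl_min sXX')).
have s : Y \subset E :\ x :\: X' by sset.
exact: subsetP (clS M s) _ clY.
Qed.

(* Otherwise X would lie in the closure of A, hence f in the closure of E - X. *)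
Lemma flat_compl_vsep_rk X f A : (forall z, z \in X -> z \notin cl (E :\: X)) ->
  f \in X -> vsep f A -> r (f |: (cl X :&: A)) < r X.
Proof.
move=> flat fX vA; rewrite ltnNge; apply/negP => le.
have /vsepP [[fE sA fA] [rA rB h clA clB]] := vA.
have sXA : X \subset cl A.
  have s1 : f |: (cl X :&: A) \subset cl X.
    by rewrite subUset subsetIl sub1set (mem_cl M fX).
  have s2 : cl X \subset cl (f |: (cl X :&: A)).
    by apply: rk_eq_cl => //; rewrite rk_cl.
  apply: subset_trans (sub_cl _ _) (subset_trans s2 _).
  apply: cl_min; have sc := sub_cl M A.
  by apply/subsetP=> z; rewrite !inE => /orP [/eqP ->|/andP [_ /(subsetP sc)]].
have := vsep_trim (vsep_sym vA) => /vsepP [_ [_ _ _ clB' _]].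
case/negP: (flat f fX); apply: subsetP clB'; apply: clS.
have -> : E :\ f :\: (E :\ f :\: A) = A by sset.
sset.
Qed.

(** Submodularity bounds the connectivities of the union and the intersection together from above,
    and 3-connectedness bounds each from below. Both bounds are attained. *)
Lemma uncross_cl X A e : e \in X -> X \subset E -> r X + r (E :\: X) <= (r E).+2 ->
  vsep e A -> 1 < #|E :\: (X :|: A)| -> 1 < #|X :&: A| -> e \in cl (X :&: A) /\
  r (X :&: A) + r (E :\ e :\: (X :&: A)) = (r E).+2.
Proof.
move=> eX sX hX vA c1 c2.
have /vsepP [[eE sA eA] [rA rB h clA clB]] := vA.
have sB : E :\ e :\: A \subset E :\ e :\: (X :&: A) by sset.
have clD := subsetP (clS M sB) _ clB.
(* As [e] lies in [X] and in [cl A], the intersection may include [e] at no cost; tightness then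
   puts [e] in [cl (X :&: A)]. *)
submod M (X :|: A) (e |: (X :&: A)) X (e |: A).
submod M (E :\ e :\: (X :&: A)) (E :\: (X :|: A)) (E :\: X) (E :\ e :\: A).
have h1 : (r E).+2 <= r (X :|: A) + r (E :\: (X :|: A)).
  apply: conn2 => //; first by sset.
  have -> : E :\: (E :\: (X :|: A)) = X :|: A by sset.
  by apply: leq_trans c2 (subset_leq_card _); sset.
have h2 : (r E).+2 <= r (X :&: A) + r (e |: (E :\ e :\: (X :&: A))).
  apply: conn2 => //; first by sset.
    by apply: leq_trans c2 (subset_leq_card _); sset.
  by apply: leq_trans c1 (subset_leq_card _); sset.
move/clP: clA; move/clP: clD => hD hA.
rkmono M (X :&: A) (e |: (X :&: A)) => *.
split; last by rlia.
apply/clP; rlia.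
Qed.

Lemma uncross_vsep X A e : e \in X -> X \subset E -> r X + r (E :\: X) <= (r E).+2 ->
  vsep e A -> 1 < #|E :\: (X :|: A)| -> 2 < r (X :&: A) -> vsep e (X :&: A).
Proof.
move=> eX sX hX vA c1 rXA; have c2 := ltnW (card_rk rXA).
have [clXA h] := uncross_cl eX sX hX vA c1 c2.
have /vsepP [[eE sA eA] [rA rB hA clA clB]] := vA.
have sB : E :\ e :\: A \subset E :\ e :\: (X :&: A) by sset.
apply/vsepP; do !split=> //; [sset | sset | | exact: subsetP (clS M sB) _ clB].
by apply: leq_trans rB (rk_mono _ _).
Qed.

(** The alternative to [uncross_vsep]: when the intersection is too small to be a new vertical
    separation, it lies on a line with [e]. Applied to both sides of a separation at [e], this
    covers [X] by two lines. *)
Lemma uncross_rk2 X A e : e \in X -> X \subset E -> r X + r (E :\: X) <= (r E).+2 ->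
  vsep e A -> 1 < #|E :\: (X :|: A)| -> r (X :&: A) <= 2 -> r (e |: (X :&: A)) <= 2.
Proof.
move=> eX sX hX vA c1 rXA; have [c2|c2] := leqP #|X :&: A| 1.
  have := rkU1 M e (X :&: A); have := rk_card M (X :&: A); rlia.
by have [/clP -> _] := uncross_cl eX sX hX vA c1 c2.
Qed.

(* In [M / x] the set [L - x] is a parallel class, in series with [h]; by the
   last clause these are the only 2-separations. *)
Definition series_point x := exists L h, let Y := E :\: L :\ h in
  [/\ x \in L, 1 < #|L|, L \subset E & h \in E :\: L] /\
  [/\ r L <= 2, h \notin cl (x |: Y) &
  forall U : {set T}, U \subset Y -> U != set0 -> 1 < #|Y :\: U| ->
    (r E).+2 < r (x |: (Y :\: U)) + r (U :|: (h |: L))].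

(** * Vertical 3-separations at two points of one line *)

Section TwoBad.
Variables (L : {set T}) (h x : T).
Let Y := E :\: L :\ h.
Hypotheses (sL : L \subset E) (hE : h \in E) (hL : h \notin L) (xL : x \in L).
Hypotheses (rL : r L <= 2) (rX : r (h |: (L :\ x)) = 3).
Hypotheses (xX : x \in cl (h |: (L :\ x))) (rY : (r (x |: Y)).+1 = r E).
Hypothesis flat : forall z, z \in h |: (L :\ x) -> z \notin cl (x |: Y).
Hypothesis plane : forall z, z \in Y -> z \notin cl L.

(** The separation at [e] keeps [L :\ e] together, away from [h]. Indeed the part of the plane on
    the side of [h] is collinear with [e], so a second point of [L] there would put [h] on [L] and
    make the plane a line. [G] is what the side of [L] contains off [L]. *)
Lemma split_along_plane e : e \in L -> e != x -> vsep_point e -> exists G : {set T},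
  [/\ G \subset Y, G != set0 & e \in cl (h |: (Y :\: G))] /\
  [/\ r (Y :\: G) + r (G :|: L) = (r E).+1, 1 < r (Y :\: G) & h \notin cl (G :|: L)].
Proof.
move=> eL ex be; have dY : Y = E :\: L :\ h by [].
have eE : e \in E by sset.
have he : h != e by apply: contraNneq hL => ->.
have hx : h != x by apply: contraNneq hL => ->.
pose X := h |: (L :\ x); have dX : X = h |: (L :\ x) by [].
have sX : X \subset E by sset.
have eX : e \in X by rewrite !inE ex eL orbT.
have hX : h \in X by rewrite !inE eqxx.
have eXY : E :\: X = x |: Y.
  apply/setP=> z; rewrite !inE; case: (eqVneq z x) => [->|zx] /=.
    by rewrite (negbTE (_ : x != h)) ?(subsetP sL) // eq_sym.
  by case: (z == h); case: (z \in L); rewrite //= ?andbT.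
have sFX : h |: L \subset cl X.
  apply/subsetP=> z; rewrite !inE => /orP [/eqP ->|zL]; first exact: mem_cl.
  case: (eqVneq z x) => [->|zx] //.
  by apply: mem_cl; rewrite !inE zx zL orbT.
have [A vA hA] : exists2 A, vsep e A & h \notin A.
  have /existsP [A vA] := be.
  case: (boolP (h \in A)) => hA; last by exists A.
  by exists (E :\ e :\: A); [exact: vsep_sym | rewrite !inE hA].
have /vsepP [[_ sA eA] [rA rB hAB clA clB]] := vA.
set B := E :\ e :\: A in rB hAB clB.
have flatX z : z \in X -> z \notin cl (E :\: X) by rewrite eXY; apply: flat.
have hB : h \in B by rewrite !inE hA he.
have rW : r (e |: (cl X :&: B)) <= 2.
  by have := flat_compl_vsep_rk flatX eX (vsep_sym vA); rewrite -/B [r X]rX.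
have sLA : L :\ e \subset A.
  apply/subsetP=> l; rewrite !inE => /andP [le lL]; apply: contraT => lA.
  have lB : l \in B by rewrite !inE lA le (subsetP sL).
  pose W := e |: (cl X :&: B); have eW : e \in W by rewrite !inE eqxx.
  have sWE : W \subset E.
    by apply/subsetP=> z; rewrite !inE => /orP [/eqP ->|/and3P [_ _ /andP [_ ->]]].
  have lW : l \in W by rewrite in_setU1 in_setI lB (subsetP sFX) ?orbT // !inE lL orbT.
  have hW : h \in W by rewrite in_setU1 in_setI hB (subsetP sFX) ?orbT // !inE eqxx.
  have el : e != l by rewrite eq_sym.
  have s1 := line_cl eW lW el sWE rW.
  have s2 := line_cl eL lL el sL rL.
  have s3 : X \subset cl [set e; l].
    apply/subsetP=> z; rewrite !inE => /orP [/eqP ->|/andP [_ zL]].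
      exact: (subsetP s1).
    exact: (subsetP s2).
  have := rk_mono M s3; rewrite rk_cl [r X]rX.
  by have := rk_card M [set e; l]; rewrite cards2; case: (_ != _) => /=; rlia.
pose G := A :\: L; have dG : G = A :\: L by [].
have sG : G \subset Y.
  apply/subsetP=> z; rewrite !inE => /andP [zL zA]; rewrite zL (subsetP sA) //= andbT.
  by apply: contraNneq hA => <-.
have eB : B = h |: (Y :\: G).
  apply/setP=> z; rewrite !inE; case: (eqVneq z h) => [->|zh] /=.
    by rewrite hA he hE.
  case: (eqVneq z e) => [->|ze] /=; first by rewrite eL /= !andbF.
  case: (boolP (z \in L)) => zL /=; last by case: (z \in A).
  by rewrite (subsetP sLA) //= !inE ze zL.
have eA' : e |: A = G :|: L.
  apply/setP=> z; rewrite !inE; case: (eqVneq z e) => [->|ze] /=.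
    by rewrite eL orbT.
  case: (boolP (z \in L)) => zL /=; last by rewrite orbF.
  by rewrite (subsetP sLA) // !inE ze zL.
have rGL : r (G :|: L) = r A by rewrite -eA'; apply/clP.
(* So [h] adds one to the rank of its side; removing it turns r E + 2 into r E + 1. *)
have hP : h \notin cl (Y :\: G).
  have s : Y :\: G \subset x |: Y by sset.
  by apply: contra (flat hX); apply: subsetP (clS M s) _.
have := notclP hP; rewrite -eB => rBP.
exists G; do !split=> //.
- apply: contraTneq rA => G0; rewrite -leqNgt; apply: leq_trans rL.
  apply: rk_mono; apply/subsetP=> z zA; apply: contraT => zL.
  by have := in_set0 z; rewrite -G0 !inE zL zA.
- by rewrite -eB.
- by rewrite rGL; rlia.
- by rlia.
apply/negP => /clP hGL.
have : (r E).+2 <= r (Y :\: G) + r (h |: (G :|: L)).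
  apply: conn2 => //; first by sset.
    apply: leq_trans (_ : 1 < #|Y :\: G|) (subset_leq_card _); last by sset.
    by apply: card_rk; rlia.
  by apply: (card_ge2 ex); sset.
by rlia.
Qed.

(** The two separations are uncrossed until [G1] and [G2] turn out to be disjoint single points [b]
    and [a]. The rank bounds then say that [h |: (Y :\ b)] and [h |: (Y :\ a)] are not spanning. *)
Lemma two_vsep_points_cocircuits e f : e \in L -> f \in L -> e != x -> f != x -> e != f ->
  vsep_point e -> vsep_point f -> exists a b, [/\ a \in Y, b \in Y & a != b] /\
  [/\ e \in cl (h |: (Y :\ b)), (r (Y :\ b)).+2 <= r E,
      f \in cl (h |: (Y :\ a)) & (r (Y :\ a)).+2 <= r E].
Proof.
move=> eL fL ex fx ef be bf; have dY : Y = E :\: L :\ h by [].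
have [G1 [[sG1 G1n clP1] [r1 rP1 hG1]]] := split_along_plane eL ex be.
have [G2 [[sG2 G2n clP2] [r2 rP2 hG2]]] := split_along_plane fL fx bf.
have eE : e \in E by sset.
have fE : f \in E by sset.
have xE : x \in E by sset.
have neh z : z \in L -> z != h by move=> zL; apply: contraNneq hL => <-.
have eh := neh e eL; have fh := neh f fL; have xh := neh x xL.
have hX : h \in h |: (L :\ x) by rewrite !inE eqxx.
have nY z Z : z \in h |: (L :\ x) -> Z \subset x |: Y -> z \notin cl Z.
  by move=> zX sZ; apply: contra (flat zX); apply: subsetP (clS M sZ) _.
have eX : e \in h |: (L :\ x) by rewrite !inE ex eL orbT.
have fX : f \in h |: (L :\ x) by rewrite !inE fx fL orbT.
have sLef : L \subset cl [set e; f] by apply: line_cl.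
set P1 := Y :\: G1 in clP1 r1 rP1; set P2 := Y :\: G2 in clP2 r2 rP2.
have dP1 : P1 = Y :\: G1 by []. have dP2 : P2 = Y :\: G2 by [].
have hxL : h |: (L :\ x) \subset h |: L by sset.
(* Otherwise [P2] lies in [G1], and exchanging [f] and [h] in [clP2] puts [h] in [cl (G1 :|: L)]. *)
have Qn : P1 :&: P2 != set0.
  apply: contra hG1 => /eqP Q0.
  have s2 : P2 \subset G1 by sset.
  have f2 : f \notin cl P2 by apply: nY => //; sset.
  have s3 : f |: P2 \subset G1 :|: L by sset.
  exact: subsetP (clS M s3) _ (cl_exch clP2 f2).
have [q qQ] := set0Pn _ Qn.
have hq : h != q by apply: contraTneq qQ => <-; rewrite !inE eqxx /= ?andbF.
have hQ : h \notin cl (P1 :&: P2) by apply: nY => //; sset.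
have Q1 : (r E).+1 <= r (P1 :&: P2) + r (G1 :|: G2 :|: L).
  have : (r E).+2 <= r (h |: (P1 :&: P2)) + r (G1 :|: G2 :|: L).
    apply: conn2 => //; first by sset.
      by apply: (card_ge2 hq); sset.
    by apply: (card_ge2 ex); sset.
  rewrite (notclP hQ); rlia.
submod M (P1 :|: P2) (P1 :&: P2) P1 P2.
pose Z := G1 :&: G2; have dZ : Z = G1 :&: G2 by [].
submod M (G1 :|: G2 :|: L) (Z :|: L) (G1 :|: L) (G2 :|: L) => s1 s2.
have s3 : r (P1 :|: P2) + r (Z :|: L) <= (r E).+1 by rlia.
have rPP : r (h |: (P1 :|: P2 :|: L)) <= (r (P1 :|: P2)).+1.
  apply: leq_trans (rkU1 M h _).
  have s : h |: (P1 :|: P2 :|: L) \subset cl (h |: (P1 :|: P2)).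
    apply/subsetP=> z; rewrite in_setU1 in_setU => /or3P [/eqP ->|zP|zL].
    - by apply: mem_cl; rewrite !inE eqxx.
    - by apply: mem_cl; rewrite in_setU1 zP orbT.
    apply: (subsetP (cl_min (X := [set e; f]) _)) (subsetP sLef _ zL).
    have t1 : h |: P1 \subset h |: (P1 :|: P2) by sset.
    have t2 : h |: P2 \subset h |: (P1 :|: P2) by sset.
    apply/subsetP=> y; rewrite !inE => /orP [] /eqP ->.
      exact: subsetP (clS M t1) _ clP1.
    exact: subsetP (clS M t2) _ clP2.
  by have := rk_mono M s; rewrite rk_cl.
(* By [s3] and [rPP], a nonempty [Z] and its complement have ranks adding up to at most r E + 1, and
   to at most r E when [Z] is a single point, since [r (Z :|: L)] is then at least 3. Both
   contradict 3-connectedness. *)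
have Z0 : Z = set0.
  apply/eqP; apply: contraT => Zn.
  have eZ : e \notin cl Z by apply: nY => //; sset.
  have rZL : (r Z).+1 <= r (Z :|: L) by rewrite -(notclP eZ); apply: rk_mono; sset.
  have cZ : 0 < #|Z| by rewrite card_gt0.
  have c2 : 1 < #|E :\: Z| by apply: (card_ge2 ex); sset.
  have [c1|c1] := leqP #|Z| 1; last first.
    have : (r E).+2 <= r Z + r (h |: (P1 :|: P2 :|: L)).
      apply: conn2 => //; first by sset.
      by apply: leq_trans c1 (subset_leq_card _); sset.
    by rlia.
  have [z zZ] := set0Pn _ Zn; have zY : z \in Y by sset.
  have := notclP (plane zY) => rzL.
  have rL2 : 2 <= r L by rewrite -(rk2E eE fE ef); apply: rk_mono; sset.
  have : r (z |: L) <= r (Z :|: L) by apply: rk_mono; rewrite setSU ?sub1set.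
  have : (r E).+1 <= r Z + r (h |: (P1 :|: P2 :|: L)).
    apply: conn1 => //; first by sset.
      by apply: leq_trans cZ (subset_leq_card _); sset.
    by rlia.
  have := rk_card M Z; rlia.
have s12 : G1 \subset P2.
  apply/subsetP=> z zG; have := in_set0 z.
  rewrite -Z0 in_setI zG /= => zn; rewrite in_setD zn; exact: subsetP sG1 z zG.
have s21 : G2 \subset P1.
  apply/subsetP=> z zG; have := in_set0 z.
  rewrite -Z0 in_setI zG andbT => zn; rewrite in_setD zn; exact: subsetP sG2 z zG.
(* Together with [h1] and [h2], these bound the total of the ranks in [k1] and [k2] by 2 r E + 2, so
   both are equalities. A [G1] or [G2] with two elements would require one more. *)
submod M (P1 :|: L) G2 P1 (G2 :|: L); submod M (P2 :|: L) G1 P2 (G1 :|: L) => s4 s5.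
have hPL g (P : {set T}) : g \in L -> g \in h |: (L :\ x) -> P \subset Y -> g \in cl (h |: P) ->
    r (h |: (P :|: L)) = r (P :|: L).
  move=> gL gX sP gc; apply/clP; have gP : g \notin cl P by apply: nY => //; sset.
  have sg : g |: P \subset P :|: L by rewrite subUset sub1set inE gL orbT subsetUl.
  exact: subsetP (clS M sg) _ (cl_exch gc gP).
have h1 := hPL e P1 eL eX ltac:(sset) clP1.
have h2 := hPL f P2 fL fX ltac:(sset) clP2.
have cG1 : 0 < #|G1| by rewrite card_gt0.
have cG2 : 0 < #|G2| by rewrite card_gt0.
have cE1 : 1 < #|E :\: G1| by apply: (card_ge2 ex); sset.
have cE2 : 1 < #|E :\: G2| by apply: (card_ge2 ex); sset.
have eG1 : E :\: (h |: (P1 :|: L)) = G1 by sset.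
have eG2 : E :\: (h |: (P2 :|: L)) = G2 by sset.
have k1 : (r E).+1 <= r G1 + r (h |: (P1 :|: L)).
  by apply: conn1; rewrite ?eG1 //; [sset | rlia].
have k2 : (r E).+1 <= r G2 + r (h |: (P2 :|: L)).
  by apply: conn1; rewrite ?eG2 //; [sset | rlia].
have c1 : #|G1| = 1.
  apply/eqP; rewrite eqn_leq cG1 andbT leqNgt; apply/negP=> c.
  have : (r E).+2 <= r G1 + r (h |: (P1 :|: L)).
    by apply: conn2; rewrite ?eG1 //; sset.
  by rlia.
have c2 : #|G2| = 1.
  apply/eqP; rewrite eqn_leq cG2 andbT leqNgt; apply/negP=> c.
  have : (r E).+2 <= r G2 + r (h |: (P2 :|: L)).
    by apply: conn2; rewrite ?eG2 //; sset.
  by rlia.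
have rGL (G : {set T}) z : G = [set z] -> z \in Y -> 3 <= r (G :|: L).
  move=> -> zY; rewrite (notclP (plane zY)) ltnS -(rk2E eE fE ef).
  by apply: rk_mono; sset.
have /cards1P [b eb] : #|G1| == 1 by apply/eqP.
have /cards1P [a ea] : #|G2| == 1 by apply/eqP.
have bY : b \in Y by rewrite (subsetP sG1) // eb set11.
have aY : a \in Y by rewrite (subsetP sG2) // ea set11.
have := rGL _ _ eb bY; have := rGL _ _ ea aY => t1 t2.
exists a, b; split; first split=> //.
  have : b \in P2 by rewrite (subsetP s12) // eb set11.
  by rewrite inE ea inE eq_sym => /andP [].
by rewrite -{1 2}eb -ea -/P1 -/P2; split=> //; rlia.
Qed.

(** If [U] violates the last clause, then [x] lies in [cl V], so [V] contains both [a] and [b]: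
    otherwise a closure meeting [L] in one point would contain two. Thus [U] avoids [a] and [b], and
    [L] adds 2 to the rank of [h |: U] but at most 1 to that of [x |: V]. This makes [h |: U] and
    [V :|: L] a 2-separation of [M]. *)
Lemma two_vsep_points_series e f : e \in L -> f \in L -> e != x -> f != x -> e != f ->
  vsep_point e -> vsep_point f -> series_point x.
Proof.
move=> eL fL ex fx ef be bf; have dY : Y = E :\: L :\ h by [].
have [a [b [[aY bY ab] [clb rb cla ra]]]] := two_vsep_points_cocircuits eL fL ex fx ef be bf.
exists L, h; split; first by split=> //; [exact: (card_ge2 ef) | rewrite inE hL].
split=> //; first by apply: flat; rewrite !inE eqxx.
move=> U sU Un; rewrite -/Y; set V := Y :\: U => cV; rewrite ltnNge; apply/negP => le.
have neh z : z \in L -> z != h by move=> zL; apply: contraNneq hL => <-.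
have sYE : Y \subset E by sset.
have eE : e \in E := subsetP sL e eL.
have fE : f \in E := subsetP sL f fL.
have sLef : L \subset cl [set e; f] by apply: line_cl.
have sLxe : L \subset cl [set x; e] by apply: line_cl => //; rewrite eq_sym.
have sLxf : L \subset cl [set x; f] by apply: line_cl => //; rewrite eq_sym.
have clV : x \in cl V.
  apply/clP; have : (r E).+2 <= r V + r (U :|: (h |: L)).
    apply: conn2 => //; first by sset.
      by apply: leq_trans cV (subset_leq_card _); sset.
    apply: (card_ge2 ef); rewrite !inE ?eE ?fE ?eL ?fL ?andbF //=.
  by rkmono M V (x |: V); rlia.
(* [P] stands for [Y :\ b] or [Y :\ a]: the hyperplane spanned by [h |: P]
   meets [L] in a single point. *)
have hyp P c u v : P = Y :\ c -> c \in Y -> (r P).+2 <= r E -> u \in cl (h |: P) ->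
    v \in cl (h |: P) -> ~~ (L \subset cl [set u; v]).
  move=> eP cY rP uP vP; apply/negP => sLuv.
  have s : L \subset cl (h |: P).
    apply: subset_trans sLuv (cl_min _); apply/subsetP=> z.
    by rewrite !inE => /orP [] /eqP ->.
  have := rkU_cl s; have := rkU1 M h P.
  have : (r E).+1 <= r [set c] + r (L :|: (h |: P)).
    apply: conn1 => //; first by rewrite eP; sset.
      rewrite card_gt0; apply/set0Pn; exists c; move: cY; rewrite eP !inE eqxx /=.
      by case: (c == h); case: (c \in L); case: (c \in E).
    have cz : c != e by apply: contraTneq cY => ->; rewrite !inE eL andbF.
    rewrite card_gt0; apply/set0Pn; exists e; rewrite !inE eE andbT eq_sym //.
  by have := rk_card M [set c]; rewrite cards1; rlia.
have inV P c u : P = Y :\ c -> c \in Y -> (r P).+2 <= r E -> u \in cl (h |: P) ->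
    L \subset cl [set x; u] -> c \in V.
  move=> eP cY rP uP sLu; apply: contraT => cV'.
  have s : V \subset h |: P.
    apply/subsetP=> z zV; rewrite eP in_setU1 in_setD1.
    case: (eqVneq z c) => [zc|_]; first by rewrite -zc zV in cV'.
    by rewrite (subsetP (subsetDl Y U) z zV) orbT.
  have := hyp P c x u eP cY rP (subsetP (clS M s) _ clV) uP.
  by rewrite sLu.
have bV := inV _ b e erefl bY rb clb sLxe.
have aV := inV _ a f erefl aY ra cla sLxf.
have sUb : U \subset Y :\ b.
  apply/subsetP=> z zU; rewrite in_setD1 (subsetP sU) // andbT.
  by apply: contraTneq bV => <-; rewrite !inE zU.
have sUa : U \subset Y :\ a.
  apply/subsetP=> z zU; rewrite in_setD1 (subsetP sU) // andbT.
  by apply: contraTneq aV => <-; rewrite !inE zU.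
have hU : h \notin cl U.
  have : h \notin cl (x |: Y) by apply: flat; rewrite !inE eqxx.
  by apply/contra/subsetP/clS; apply: subset_trans sU (subsetUr _ _).
have fU : f \notin cl (h |: U).
  apply/negP => fc; have s : h |: U \subset h |: (Y :\ b) by apply: setUS.
  by have := hyp _ b e f erefl bY rb clb (subsetP (clS M s) _ fc); rewrite sLef.
have eU : e \notin cl (f |: (h |: U)).
  apply/negP => ec.
  have s : f |: (h |: U) \subset cl (h |: (Y :\ a)).
    apply/subsetP=> z; rewrite in_setU1 => /orP [/eqP -> //|zU].
    by apply: mem_cl; apply: subsetP zU; apply: setUS.
  have := hyp _ a e f erefl aY ra (subsetP (cl_min s) _ ec) cla.
  by rewrite sLef.
have := notclP hU; have := notclP fU; have := notclP eU.
have : r (e |: (f |: (h |: U))) <= r (U :|: (h |: L)).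
  by apply: rk_mono; rewrite !subUset !sub1set !inE eL fL eqxx subsetUl !orbT.
have : r (V :|: L) <= (r (x |: V)).+1.
  have s : V :|: L \subset cl (e |: (x |: V)).
    rewrite subUset; apply/andP; split.
      apply: subset_trans (sub_cl M _); rewrite setUA; exact: subsetUr.
    apply: subset_trans sLxe (clS _ _).
    by rewrite subUset !sub1set !inE !eqxx !orbT.
  by have := rk_mono M s; rewrite rk_cl; have := rkU1 M e (x |: V); rlia.
have [u uU] := set0Pn _ Un.
have uY : u \in Y := subsetP sU u uU.
have : (r E).+2 <= r (h |: U) + r (V :|: L).
  apply: conn2 => //; first by sset.
    have hu : h != u by apply: contraTneq uY => <-; rewrite !inE eqxx.
    apply: (card_ge2 hu); first by rewrite !inE eqxx hE (negbTE hL) /= andbF.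
    by move: uY; rewrite !inE uU /=; case: (u == h); case: (u \in L).
  apply: (card_ge2 ef).
    by rewrite !inE eE (negbTE (neh _ eL)) andbT /=; apply/negP=> /(subsetP sU);
       rewrite !inE eL andbF.
  by rewrite !inE fE (negbTE (neh _ fL)) andbT /=; apply/negP=> /(subsetP sU);
     rewrite !inE fL andbF.
rlia.
Qed.
End TwoBad.

End Vertical.

(** * The smallest vertical 3-separation *)

Section Main.
Variables (T T' : finType) (M : matroid T) (N : matroid T') (Cs : {set T}).
Local Notation E := (ground M).
Local Notation r := (rk M).
Local Notation cl := (mclosure M).
Implicit Types (A B C X Y Z L R : {set T}) (a b e f x : T).
Hypotheses (M3 : connected M 3) (cE : 3 < #|E|).

Definition contractible x := exists C g, minor_via M N C g /\ x \in C.

(** A fan stated by ranks; in a 3-connected matroid with at least four elements these inequalities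
    force a triangle and a triad. Dualizing exchanges the two, so the sequence is finally read
    backwards. *)
Definition fan_like x1 x2 x3 x4 :=
  [/\ uniq [:: x1; x2; x3; x4], [set x1; x2; x3; x4] \subset E,
      r [set x1; x2; x3] <= 2 & r (E :\: [set x2; x3; x4]) < r E].

(** The dual outcomes, with connectivity expressed in [M] itself: no vertical 3-separation at [x]
    stands for si (M / x) being 3-connected, and [series_point] for its becoming so after
    simplifying the dual. *)
Definition contraction_outcome :=
  [\/ exists2 x, x \in Cs & contractible x /\ ~~ vsep_point M x,
      exists2 x, x \in Cs & contractible x /\ series_point M x
    | exists x1 x2 x3 x4, [/\ fan_like x1 x2 x3 x4, x1 \in Cs, x3 \in Cs,
        contractible x2 & ~~ vsep_point M x2]].

Section Plane.
Variables (X : {set T}) (e : T).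
Hypotheses (sX : X \subset E) (rX : r X = 3) (eX : e \in X).
Hypothesis flatX : forall z, z \in X -> z \notin cl (E :\: X).
Let F := E :&: cl X.

(** Of three points of [L2], two lie on the same side of a separation at [f], and that side meets
    the plane in points collinear with [f]. Then [f] lies on the line of [L2], and the plane
    collapses to it. *)
Lemma vsep_point_line L1 L2 f : e \in L1 -> e \in L2 -> L1 \subset F -> L2 \subset F ->
  F \subset L1 :|: L2 -> r L1 <= 2 -> r L2 <= 2 ->
  f \in L1 -> f \notin L2 -> f \in X -> vsep_point M f -> #|L2| <= 2.
Proof.
move=> e1 e2 s1 s2 sF r1 r2 f1 f2 fX /existsP [A vA]; rewrite leqNgt; apply/negP=> c2.
have /vsepP [[fE _ fA] _] := vA.
have key B : vsep M f B -> 1 < #|L2 :&: B| -> False.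
  move=> vB /card_gt1P [a [b [aB bB ab]]].
  have w := flat_compl_vsep_rk M3 cE flatX fX vB; rewrite rX in w.
  pose W := f |: (F :&: B).
  have sWE : W \subset E by apply/subsetP=> z; rewrite !inE => /orP [/eqP ->|/andP [/andP []]].
  have rW : r W <= 2.
    by apply: leq_trans (_ : _ <= r (f |: (cl X :&: B))) w; apply: rk_mono; rewrite /W /F; sset.
  have [a2 aB'] : a \in L2 /\ a \in B by apply/andP; rewrite -in_setI.
  have [b2 bB'] : b \in L2 /\ b \in B by apply/andP; rewrite -in_setI.
  have aW : a \in W by rewrite in_setU1 in_setI (subsetP s2) // aB' orbT.
  have bW : b \in W by rewrite in_setU1 in_setI (subsetP s2) // bB' orbT.
  have sFE : F \subset E := subsetIl _ _.
  have t1 := line_cl M3 cE aW bW ab sWE rW.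
  have t2 := line_cl M3 cE a2 b2 ab (subset_trans s2 sFE) r2.
  have ef : e != f by apply: contraNneq f2 => <-.
  have t3 := line_cl M3 cE e1 f1 ef (subset_trans s1 sFE) r1.
  have t4 : X \subset cl [set a; b].
    have sXF : X \subset F by rewrite subsetI sX sub_cl.
    apply: subset_trans sXF (subset_trans sF _); rewrite subUset t2 andbT.
    apply: subset_trans t3 (cl_min _); rewrite subUset !sub1set.
    by rewrite (subsetP t2) // (subsetP t1) // !inE eqxx.
  have := rk_mono M t4; rewrite rk_cl rX; have := rk_card M [set a; b].
  by rewrite cards2 ab; rlia.
have [c|c] := ltnP 1 #|L2 :&: A|; first exact: key vA c.
apply: (key _ (vsep_sym vA)); have := cardsID A L2.
have : #|L2 :\: A| <= #|L2 :&: (E :\ f :\: A)|.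
  apply: subset_leq_card; apply/subsetP=> z; rewrite !inE => /andP [zA z2].
  rewrite z2 zA; have := subsetP s2 z z2; rewrite inE => /andP [-> _].
  by rewrite andbT; apply: contraNneq f2 => <-.
rlia.
Qed.
End Plane.

Hypotheses (sCs : Cs \subset E) (Cflat : forall c, c \in Cs -> c \notin cl (E :\: Cs)).

Lemma rank3_vsep_outcome x e X : x \in Cs -> e \in Cs -> vsep M x X -> r X = 3 -> e \in X ->
  (forall z, z \in X -> z \notin cl (E :\: X)) -> vsep_point M e ->
  (forall f, f \in X -> contractible f) -> contractible x -> contraction_outcome.
Proof.
move=> xC eC vx rX eX flatX be hasX hx.
have /vsepP [[xE sX xX] [_ rY hXY clX clY]] := vx.
have exXY : E :\: X = x |: (E :\ x :\: X) by sset.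
have rEX : (r (E :\: X)).+1 = r E by rewrite exXY; move/clP: clY => ->; rlia.
pose F := E :&: cl X.
have sXF : X \subset F by rewrite subsetI sX sub_cl.
have xF : x \in F by rewrite inE xE clX.
have nex : e != x by apply: contraTneq eX => ->.
have [A vA xA] : exists2 A, vsep M e A & x \in A.
  have /existsP [A vA] := be.
  case: (boolP (x \in A)) => xA; first by exists A.
  exists (E :\ e :\: A); first exact: vsep_sym.
  by rewrite !inE xA xE eq_sym nex.
have wA := flat_compl_vsep_rk M3 cE flatX eX vA; have wB := flat_compl_vsep_rk M3 cE flatX eX (vsep_sym vA).
rewrite rX in wA wB.
have eE : e \in E by sset.
have eF : e \in F by rewrite (subsetP sXF).
(* [L] is the part of the plane on the side of [x], with [e]; [R] is the rest, without [e], so that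
   the two are disjoint. *)
have [L [R [[eL xL eR] [sL sR sF] [rL rR] dLR]]] : exists L R : {set T},
  [/\ [/\ e \in L, x \in L & e \notin R], [/\ L \subset F, R \subset F & F \subset L :|: R],
    r L <= 2 /\ r (e |: R) <= 2 & forall z, z \in R -> z \notin L].
  exists (e |: (F :&: A)), (F :\: (e |: (F :&: A))); do !split.
  - by rewrite !inE eqxx.
  - by rewrite in_setU1 in_setI xF xA orbT.
  - by rewrite !inE eqxx.
  - by sset.
  - by sset.
  - by sset.
  - apply: leq_trans (_ : _ <= r (e |: (cl X :&: A))) wA; apply: rk_mono.
    by rewrite /F; sset.
  - apply: leq_trans (_ : _ <= r (e |: (cl X :&: (E :\ e :\: A)))) wB; apply: rk_mono.
    apply/subsetP=> z; rewrite !inE; case: (z == e) => //=.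
    by case: (z \in E); case: (z \in cl X); case: (z \in A).
  - by move=> z; rewrite inE => /andP [].
clear A vA xA wA wB.
have sLE : L \subset E := subset_trans sL (subsetIl _ _).
have sRE : R \subset E := subset_trans sR (subsetIl _ _).
have sLX : L :\ x \subset X.
  apply/subsetP=> l; rewrite !inE => /andP [lx lL]; apply: contraT => lX.
  have xl : x != l by rewrite eq_sym.
  have t := line_cl M3 cE xL lL xl sLE rL.
  have s : [set x; l] \subset E :\: X.
    by rewrite subUset !sub1set !inE xE xX lX (subsetP sLE).
  have := flatX e eX; rewrite (subsetP (clS M s)) //.
  exact: subsetP t e eL.
have [h hX hR] : exists2 h, h \in X & h \in R.
  have /subsetPn [h hX hL] : ~~ (X \subset L).
    by apply/negP => s; have := rk_mono M s; rlia.
  exists h => //; have := subsetP sF h (subsetP sXF h hX).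
  by rewrite inE (negbTE hL).
have hL := dLR h hR.
case: (boolP [exists f in L, [&& f != e, f != x & vsep_point M f]]) => [/exists_inP|/exists_inPn ngood].
  move=> [f fL /and3P [fe fx bf]].
  have fX : f \in X by rewrite (subsetP sLX) // !inE fx fL.
  have fR : f \notin e |: R.
    by rewrite !inE (negbTE fe) /=; apply/negP => /dLR; rewrite fL.
  have sF' : F \subset L :|: (e |: R) by apply: subset_trans sF _; sset.
  have eRF : e |: R \subset F by rewrite subUset sub1set eF.
  (* A vertical separation at [f] leaves only two points on the other line, [e] and [h]. *)
  have c := vsep_point_line sX rX flatX eL (setU11 e R) sL eRF sF' rL rR fL fR fX bf.
  have eRh : R = [set h].
    apply/eqP; rewrite eq_sym eqEcard sub1set hR cards1.
    by move: c; rewrite cardsU1 eR; rlia.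
  have eXL : X = h |: (L :\ x).
    apply/eqP; rewrite eqEsubset subUset sub1set hX sLX !andbT.
    apply/subsetP=> z zX; have := subsetP sF z (subsetP sXF z zX).
    rewrite eRh !inE => /orP [zL|->] //; rewrite zL andbT.
    by rewrite (_ : z != x) ?orbT //; apply: contraTneq zX => ->.
  apply: Or32; exists x => //; split=> //.
  have eYX : x |: (E :\: L :\ h) = E :\: X.
    rewrite eXL; apply/setP=> z; rewrite !inE.
    case: (eqVneq z x) => [->|zx] /=; last by case: (z == h); case: (z \in L).
    by rewrite xE orbF andbT; apply/esym; apply: contraNneq hL => <-.
  apply: (@two_vsep_points_series _ M M3 cE L h x sLE _ hL xL rL _ _ _ _ _ e f eL fL nex fx _ be bf).
  - exact: subsetP hX.
  - by rewrite -eXL.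
  - by rewrite -eXL.
  - by rewrite eYX.
  - by rewrite eYX -eXL.
  - move=> z; rewrite !inE => /and3P [zh zL zE]; apply/negP => zc.
    have sLc : L \subset cl X by apply: subset_trans sL (subsetIr _ _).
    have zF : z \in F by rewrite inE zE (subsetP (cl_min sLc)).
    by have := subsetP sF z zF; rewrite eRh !inE (negbTE zL) (negbTE zh).
  - by rewrite eq_sym.
have good f : f \in L -> f != e -> f != x -> ~~ vsep_point M f.
  by move=> fL fe fx; have := ngood f fL; rewrite fe fx.
case: (boolP [exists f in L, [&& f != e, f != x & f \in Cs]]) => [/exists_inP|/exists_inPn nC].
  move=> [f fL /and3P [fe fx fC]]; apply: Or31; exists f => //; split; last exact: good.
  by apply: hasX; rewrite (subsetP sLX) // !inE fx fL.
have [b bL /andP [be' bx]] : exists2 b, b \in L & (b != e) && (b != x).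
  apply/exists_inP; apply: contraT => /exists_inPn nb.
  have : r X <= r (e |: R); last by rlia.
  apply: rk_mono; apply/subsetP=> z zX; have := subsetP sF z (subsetP sXF z zX).
  rewrite !inE => /orP [zL|-> //]; last by rewrite orbT.
  have := nb z zL; case: (z == e) => //=; rewrite negbK => /eqP zx.
  by rewrite -zx zX in xX.
have bC : b \notin Cs by have := nC b bL; rewrite be' bx.
have bX : b \in X by rewrite (subsetP sLX) // !inE bx bL.
(* Orthogonality with [Cs]: two points off [Cs] on a line through [e] would span [e]. *)
have out u v Z : u \in Z -> v \in Z -> u != v -> e \in Z -> Z \subset E -> r Z <= 2 ->
    u \notin Cs -> v \notin Cs -> False.
  move=> uZ vZ uv eZ sZ rZ uC vC; have t := line_cl M3 cE uZ vZ uv sZ rZ.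
  have s : [set u; v] \subset E :\: Cs.
    by rewrite subUset !sub1set !inE uC vC !(subsetP sZ).
  by have := Cflat eC; rewrite (subsetP (clS M s)) // (subsetP t).
have bU z : z \in L -> z != e -> z != x -> z = b.
  move=> zL ze zx; apply/eqP; apply: contraT => zb; exfalso.
  by apply: (out z b L) => //; have := nC z zL; rewrite ze zx.
have cL : 2 < #|L|.
  have : #|[set e; x; b]| <= #|L| by apply: subset_leq_card; rewrite !subUset !sub1set eL xL bL.
  have -> : [set e; x; b] = b |: [set e; x] by rewrite setUC.
  by rewrite cardsU1 cards2 nex !inE (negbTE be') (negbTE bx).
(* The roles of the two lines are exchanged: [L] has the three points [e], [x] and [b]. *)
have goodR d : d \in R -> d \in X -> ~~ vsep_point M d.
  move=> dR dX; apply/negP=> bd.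
  have eRF : e |: R \subset F by rewrite subUset sub1set eF.
  have sF' : F \subset (e |: R) :|: L by apply: subset_trans sF _; sset.
  have dR' : d \in e |: R by rewrite in_setU1 dR orbT.
  have := vsep_point_line sX rX flatX (setU11 e R) eL eRF sL sF' rR rL dR' (dLR d dR) dX bd.
  by rlia.
case: (boolP [exists d in R, (d \in X) && (d \in Cs)]) => [/exists_inP|/exists_inPn nR].
  by move=> [d dR /andP [dX dC]]; apply: Or31; exists d => //; split; [apply: hasX | apply: goodR].
have hC : h \notin Cs by have := nR h hR; rewrite hX.
have hU z : z \in R -> z \in X -> z = h.
  move=> zR zX; apply/eqP; apply: contraT => zh; exfalso.
  have eRE : e |: R \subset E by rewrite subUset sub1set eE.
  apply: (out z h (e |: R)); rewrite ?in_setU1 ?zR ?hR ?eqxx ?orbT //.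
  by have := nR z zR; rewrite zX.
have eXX : X = [set b; e; h].
  apply/eqP; rewrite eqEsubset !subUset !sub1set bX eX hX !andbT.
  apply/subsetP=> z zX; have := subsetP sF z (subsetP sXF z zX).
  rewrite !inE => /orP [zL|zR]; last by rewrite (hU z zR zX) eqxx orbT.
  case: (eqVneq z e) => [|ze]; first by rewrite orbT.
  by rewrite (bU z zL ze _) ?eqxx //; apply: contraTneq zX => ->.
apply: Or33; exists x, b, e, h; split=> //; last by apply: good.
  split.
  - rewrite /= !inE !negb_or ![x == _]eq_sym bx nex be' (negbTE (_ : b != h)) /=.
    + rewrite (negbTE (_ : e != h)) /=.
        by rewrite andbT; apply: contraNneq hL => ->.
      by apply: contraNneq hL => <-.
    by apply: contraNneq hL => <-.
  - by rewrite !subUset !sub1set xE eE !(subsetP sX).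
  - by apply: leq_trans rL; apply: rk_mono; rewrite !subUset !sub1set xL bL eL.
  - by rewrite -eXX; rlia.
exact: hasX.
Qed.

Hypotheses (N3 : connected N 3) (cN : 3 < #|ground N|).

(** Since [x] lies in both closures, contracting it lowers all three ranks by one, and a vertical
    3-separation becomes an exact 2-separation, as the small-side lemmas require. *)
Lemma contract_vsep_rk x X : vsep M x X -> let K := contract M [set x] in
  [/\ X \subset ground K, ground K :\: X = E :\ x :\: X,
   rk K X + rk K (ground K :\: X) = (rk K (ground K)).+1 &
   forall f, f \notin cl (E :\ x :\: X) -> f \notin mclosure K (E :\ x :\: X)].
Proof.
move=> /vsepP [[xE sX xX] [rX rY h clX clY]] /=.
have le Z : r [set x] <= r (Z :|: [set x]) by apply: rk_mono; apply: subsetUr.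
have r1 := rk1E M3 cE xE.
split=> //; first by sset.
- rewrite /con_rk ![_ :|: [set x]]setUC.
  move/clP: clX => ->; move/clP: clY => ->; rewrite r1 setD1K //; rlia.
move=> f fY; apply/negP => /clP /=; rewrite /con_rk.
move/clP: (clY) => hY; have := notclP fY.
have := le (f |: (E :\ x :\: X)); have := le (E :\ x :\: X).
have -> : E :\ x :\: X :|: [set x] = x |: (E :\ x :\: X) by rewrite setUC.
have -> : f |: (E :\ x :\: X) :|: [set x] = x |: (f |: (E :\ x :\: X)) by rewrite setUC.
rkmono M (f |: (E :\ x :\: X)) (x |: (f |: (E :\ x :\: X))).
rlia.
Qed.

Lemma minor_via_contract_vsep x X C g f : vsep M x X -> minor_via M N C g -> x \in C ->
  #|g @: ground N :&: X| <= 1 -> f \in X -> f \notin cl (E :\ x :\: X) ->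
  exists C2 g2, [/\ minor_via M N C2 g2, x \in C2, f \in C2 &
    #|g2 @: ground N :&: X| <= 1].
Proof.
move=> vx w xC c1 fX fY; have [sX eY hr nc] := contract_vsep_rk vx.
have /vsepP [[xE _ xX] _] := vx.
have /(minor_via_contractP N g xE xC) w' := w.
have fK : f \notin mclosure (contract M [set x]) (ground (contract M [set x]) :\: X).
  by rewrite eY; apply: nc.
have cN1 : 1 < #|ground N| by apply: ltn_trans cN.
have [C2 [g2 [w2 fC2 c2]]] := minor_via_contract sX hr fX fK N3 cN1 w' c1.
have xC2 : x \notin C2.
  by have [sC2 _ _ _] := w2; apply/negP => /(subsetP sC2); rewrite !inE eqxx.
exists (x |: C2), g2; rewrite !inE eqxx fC2 orbT; split=> //.
apply/(minor_via_contractP N g2 xE); first by rewrite !inE eqxx.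
by rewrite setU1K.
Qed.

Lemma vsep_small_side x X C g : vsep M x X -> minor_via M N C g -> x \in C ->
  exists2 A, vsep M x A & #|g @: ground N :&: A| <= 1.
Proof.
move=> vx w xC; have [sX eY hr _] := contract_vsep_rk vx.
have /vsepP [[xE _ xX] _] := vx.
have /(minor_via_contractP N g xE xC) w' := w.
case: (minor_via_small_side N3 w' sX); first by rewrite hr.
  by move=> c; exists X.
by rewrite eY => c; exists (E :\ x :\: X) => //; apply: vsep_sym.
Qed.

(** Induction replaces the choice of a smallest [X]. It ranges over [x] and over the minor as well,
    because the smaller separation may be at another point of [Cs] and small only for the modified
    copy of [N]. *)
Lemma minimal_vsep_outcome n x X C g : #|X| <= n -> x \in Cs -> vsep M x X ->
  minor_via M N C g -> x \in C -> #|g @: ground N :&: X| <= 1 -> contraction_outcome.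
Proof.
elim: n x X C g => [|n IH] x X C g cX xCs vx w xC c1.
  by have /vsepP [_ [rX _ _ _ _]] := vx; have := card_rk rX; rlia.
pose Y := E :\ x :\: X.
have IH' y Z D h : #|Z| < #|X| -> y \in Cs -> vsep M y Z -> minor_via M N D h -> y \in D ->
    #|h @: ground N :&: Z| <= 1 -> contraction_outcome.
  by move=> cZ; apply: IH; rewrite -ltnS; apply: leq_trans cZ cX.
case: (boolP [exists z in X, z \in cl Y]) => [/exists_inP [z zX zY]|/exists_inPn nY].
  apply: (IH' x (X :\: cl Y) C g) => //.
  - apply: proper_card; apply/properP; split; first exact: subsetDl.
    by exists z; rewrite // inE zY.
  - exact: vsep_trim.
  by apply: leq_trans c1; apply: subset_leq_card; sset.
have /vsepP [[xE sX xX] [rX rY h clX clY]] := vx.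
have eXY : E :\: X = x |: Y by rewrite /Y; sset.
have clE : cl (E :\: X) = cl Y.
  apply/eqP; rewrite eqEsubset [X in _ && X]clS ?andbT; last by rewrite eXY subsetUr.
  by apply: cl_min; rewrite eXY subUset sub1set clY sub_cl.
have flatX z : z \in X -> z \notin cl (E :\: X) by rewrite clE; apply: nY.
have hasX f : f \in X -> exists C2 g2, [/\ minor_via M N C2 g2, x \in C2, f \in C2 &
    #|g2 @: ground N :&: X| <= 1].
  by move=> fX; apply: minor_via_contract_vsep vx w xC c1 fX (nY f fX).
(* Orthogonality: [x] is in [cl X] but not in the closure of the complement of [Cs]. *)
have /subsetPn [e eX eC] : ~~ (X \subset E :\: Cs).
  apply/negP => s; have := Cflat xCs; by rewrite (subsetP (clS M s)).
have {}eC : e \in Cs by move: eC; rewrite inE (subsetP sX) // andbT negbK.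
have hasX' f : f \in X -> contractible f by move=> /hasX [C2 [g2 [w2 _ f2 _]]]; exists C2, g2.
case: (boolP (vsep_point M e)) => be; last by apply: Or31; exists e => //; split=> //; exact: hasX'.
have [C2 [g2 [w2 xC2 eC2 c2]]] := hasX e eX.
have [A0 vA0] := existsP be.
(* The side is chosen for [g2], which is also small on [X]. *)
have [A vA cA] := vsep_small_side vA0 w2 eC2; clear A0 vA0.
have [lt|le] := ltnP #|A| #|X|; first exact: (IH' e A C2 g2).
have /vsepP [[eE sA eA] [rA rB hAB clA clB]] := vA.
have [_ g2i g2E _] := w2; pose S := g2 @: ground N.
have cS : 3 < #|S| by rewrite card_in_imset.
have hX : r X + r (E :\: X) <= (r E).+2.
  by rewrite eXY; move/clP: clY => ->; rewrite /Y h.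
(* [X] and [A] contain at most one element each of the copy of [N], which has at least four. *)
have cXA : 1 < #|E :\: (X :|: A)|.
  have := cardsID (X :|: A) S.
  have : #|S :&: (X :|: A)| <= 1 + 1.
    by rewrite setIUr; apply: leq_trans (leq_card_setU _ _) (leq_add c2 cA).
  have : #|S :\: (X :|: A)| <= #|E :\: (X :|: A)|.
    by apply: subset_leq_card; apply: setSD; apply: subset_trans g2E (subsetDl _ _).
  by rlia.
have small B : vsep M e B -> 1 < #|E :\: (X :|: B)| -> r (X :&: B) <= 2 \/ contraction_outcome.
  move=> vB cB; have [lt|] := leqP (r (X :&: B)) 2; first by left.
  move=> rXB; right; apply: (IH' e (X :&: B) C2 g2) => //.
  - apply: proper_card; apply/properP; split; first exact: subsetIl.
    by exists e; rewrite // inE eX /=; case/vsepP: vB => -[].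
  - exact: uncross_vsep.
  by apply: leq_trans c2; apply: subset_leq_card; apply: setIS; apply: subsetIl.
case: (small A vA cXA) => // r2; have w2A := uncross_rk2 M3 cE eX sX hX vA cXA r2.
pose B := E :\ e :\: A; have vB : vsep M e B by apply: vsep_sym.
(* As [A] is no smaller than [X], failure would leave [e] as the only point of [X] outside [A],
   giving [X] rank at most 2. This makes room for uncrossing with the other side [B]. *)
have cAX : 1 < #|A :\: X|.
  rewrite ltnNge; apply/negP => c; have := cardsID A X; have := cardsID X A.
  rewrite (setIC A) => k1 k2.
  have : #|X :\: A| <= 1 by rlia.
  move=> k3; have s : X \subset e |: (X :&: A).
    apply/subsetP => z zX; rewrite !inE zX /=; case: (boolP (z \in A)) => zA; first exact: orbT.
    rewrite orbF; apply: contraTT k3 => ze; rewrite -ltnNge.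
    by apply: (card_ge2 ze); rewrite inE ?zA ?eA.
  by have := rk_mono M s; rlia.
have cXB : 1 < #|E :\: (X :|: B)|.
  by apply: leq_trans cAX (subset_leq_card _); rewrite /B; sset.
case: (small B vB cXB) => // r2'; have w2B := uncross_rk2 M3 cE eX sX hX vB cXB r2'.
have rX3 : r X = 3.
  have k : r X + r [set e] <= r (e |: (X :&: A)) + r (e |: (X :&: B)).
    by apply: rk_sub; rewrite /B; sset.
  by have := rk1E M3 cE eE; rlia.
apply: (@rank3_vsep_outcome x e X) => //; exists C, g; split=> //.
Qed.

Lemma contraction_outcome_holds x0 : x0 \in Cs -> contractible x0 -> contraction_outcome.
Proof.
move=> xC hx; case: (boolP (vsep_point M x0)) => [/existsP [X0 vX0]|nb]; last first.
  by apply: Or31; exists x0.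
have [C [g [w xC']]] := hx.
have [X vX cX] := vsep_small_side vX0 w xC'.
exact: minimal_vsep_outcome (leqnn _) xC vX w xC' cX.
Qed.
End Main.

(** * Simplification: connectivity and minors *)

Section Simple.
Variables (T : finType) (K : matroid T).
Local Notation E := (ground K).
Local Notation r := (rk K).
Local Notation cl := (mclosure K).
Implicit Types (A B C X Y Z U : {set T}) (a b e f x t : T).

Lemma circuitE C : circuit K C <->
  [/\ C \subset E, r C < #|C| & forall c, c \in C -> r (C :\ c) = #|C :\ c|].
Proof.
split.
  move=> /minsetP [/= /andP [sC nC] minC]; split=> //.
    by move: nC; rewrite /indep sC /= ltn_neqAle rk_card andbT.
  move=> c cC; apply/eqP; apply: contraT => nc.
  have sc : C :\ c \subset E := subset_trans (subsetDl _ _) sC.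
  have := minC (C :\ c); rewrite /= /indep sc nc subsetDl => /(_ isT isT) eC.
  by have := setD11 c C; rewrite eC cC.
move=> [sC rC minC]; apply/minsetP; split.
  by rewrite /= /indep sC /= neq_ltn rC.
move=> B /= /andP [sB nB] sBC; apply/eqP; rewrite eqEsubset sBC /=.
apply/subsetP=> c cC; apply: contraT => cB; case/negP: nB.
rewrite /indep sB /= eqn_leq rk_card /=.
have h := minC c cC; have s : B \subset C :\ c by rewrite subsetD1 sBC cB.
submod K (C :\ c) (@set0 T) B ((C :\ c) :\: B); have := rk_card K ((C :\ c) :\: B).
have := cardsID B (C :\ c); rewrite (setIidPr s) rk0; rlia.
Qed.

Lemma loopE x : x \in E -> loop K x = (r [set x] == 0).
Proof.
move=> xE; apply/idP/eqP => [/circuitE [_ h _]|h]; first by move: h; rewrite cards1; rlia.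
apply/circuitE; rewrite sub1set xE cards1 h; split=> // c; rewrite inE => /eqP ->.
by rewrite setDv cards0 rk0.
Qed.

Lemma nonloopsE x : (x \in nonloops K) = (x \in E) && (r [set x] == 1).
Proof.
rewrite inE; case: (boolP (x \in E)) => //= xE; rewrite loopE //.
by have := rk_card K [set x]; rewrite cards1; case: (r _) => [|[]].
Qed.

Lemma parallelE x y : x \in nonloops K -> y \in nonloops K ->
  parallel K x y = (r [set x; y] == 1).
Proof.
rewrite !nonloopsE => /andP [xE /eqP rx] /andP [yE /eqP ry].
rewrite /parallel; case: (eqVneq x y) => [<-|xy] /=; first by rewrite setUid rx.
have h : r [set x] <= r [set x; y] by apply: rk_mono; apply: subsetUl.
apply/idP/eqP => [/circuitE [_ + _]|e]; first by rewrite cards2 xy; rlia.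
apply/circuitE; rewrite subUset !sub1set xE yE cards2 xy e; split=> // c.
have e1 : [set x; y] :\ x = [set y].
  by apply/setP=> z; rewrite !inE; case: (eqVneq z x) => [->|]; rewrite ?(negbTE xy).
have e2 : [set x; y] :\ y = [set x].
  apply/setP=> z; rewrite !inE; case: (eqVneq z y) => [->|]; rewrite ?orbF //=.
  by rewrite eq_sym (negbTE xy).
by rewrite !inE => /orP [/eqP ->|/eqP ->]; rewrite ?e1 ?e2 cards1.
Qed.

(** These properties are all that is used of [si] from here on; the choice of transversal no longer
    appears. *)
Lemma si_spec : let S := ground (si K) in
  [/\ S \subset E, forall X, X \subset S -> rk (si K) X = r X,
      forall t, t \in S -> r [set t] = 1,
      forall t u, t \in S -> u \in S -> t != u -> r [set t; u] = 2 &
      forall x, x \in E -> r [set x] = 1 ->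
        exists2 t, t \in S & (x \in cl [set t]) && (t \in cl [set x])].
Proof.
have pe : {in nonloops K & &, equivalence_rel (parallel K)}.
  move=> x y z xN yN zN; split; first by rewrite /parallel eqxx.
  rewrite !parallelE // => /eqP xy.
  move: (xN) (yN) (zN); rewrite !nonloopsE => /andP [xE /eqP rx] /andP [yE /eqP ry] /andP [zE /eqP rz].
  have tr a b c : r [set b] = 1 -> r [set c] = 1 -> r [set a; b] = 1 -> r [set b; c] = 1 ->
      r [set a; c] = 1.
    move=> rb rc ab bc; have : r [set c] <= r [set a; c] by apply: rk_mono; apply: subsetUr.
    submod K [set a; b; c] [set b] [set a; b] [set b; c].
    rkmono K [set a; c] [set a; b; c]; rlia.
  apply/eqP/eqP => h; last exact: tr xy h.
  by apply: tr h => //; rewrite setUC.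
pose P := parallel_classes K.
have pP : partition P (nonloops K) by apply: equivalence_partitionP.
have tP := transversalP pP; set S := transversal P (nonloops K) in tP.
have sS : S \subset nonloops K by apply: transversal_sub tP.
have sSE : S \subset E by apply: subset_trans sS _; apply/subsetP => z; rewrite inE => /andP [].
have eS : ground (si K) = S.
  by rewrite /= -/P -/S setDDr setDv set0U (setIidPr sSE).
rewrite /= in eS; rewrite /= eS.
have nl t : t \in S -> r [set t] = 1.
  by move=> /(subsetP sS); rewrite nonloopsE => /andP [_ /eqP].
have [_ _ P0] := and3P pP; have [_ tI _] := and3P pP.
split=> //.
- move=> X sX; rewrite /= /del_rk -/P -/S; congr r.
  by apply/setP=> z; rewrite !inE; case: (boolP (z \in X)) => zX; rewrite ?andbF // (subsetP sX).
- move=> t u tS uS tu; have := rk_card K [set t; u]; rewrite cards2 tu.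
  have tN := subsetP sS t tS; have uN := subsetP sS u uS.
  have : r [set t] <= r [set t; u] by apply: rk_mono; apply: subsetUl.
  rewrite nl //; have : r [set t; u] != 1; last by move/eqP; rlia.
  rewrite -parallelE //; apply: contra tu => ptu.
  have cv := cover_partition pP.
  have tb : t \in pblock P t by rewrite mem_pblock cv.
  have ub : u \in pblock P t by rewrite (pblock_equivalence_partition pe).
  have bP : pblock P t \in P by apply: pblock_mem; rewrite cv.
  have /and3P [_ _ /forall_inP /(_ _ bP) /cards1P [w ew]] := tP.
  have : t \in [set w] by rewrite -ew inE tS.
  have : u \in [set w] by rewrite -ew inE uS.
  by rewrite !inE => /eqP -> /eqP ->.
move=> x xE rx; have xN : x \in nonloops K by rewrite nonloopsE xE rx.
have cv := cover_partition pP.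
have bP : pblock P x \in P by apply: pblock_mem; rewrite cv.
have /and3P [_ _ /forall_inP /(_ _ bP) /cards1P [w ew]] := tP.
have : w \in S :&: pblock P x by rewrite ew set11.
rewrite inE => /andP [wS wb]; exists w => //.
have wN := subsetP sS w wS.
have : parallel K x w by rewrite -(pblock_equivalence_partition pe).
rewrite parallelE // => /eqP h.
by apply/andP; split; apply/clP; rewrite ?(setUC [set w]) h ?rx ?nl.
Qed.

(** [X] is the union of the parallel classes represented in [U]. Loops are left in the complement,
    where they do not affect the rank. *)
Lemma si_lift U : U \subset ground (si K) -> exists X, [/\ X \subset E, U \subset X,
  r X = r U, ground (si K) :\: U \subset E :\: X & r (E :\: X) = r (ground (si K) :\: U)] /\
  forall a b, a \in X -> b \in E -> r [set b] = 1 -> b \in cl [set a] -> b \in X.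
Proof.
have [sSE _ r1 r2 rep] := si_spec; set S := ground (si K) in sSE r1 r2 rep *.
move=> sU; pose X := [set x in E | (r [set x] == 1) && [exists t in U, x \in cl [set t]]].
have sX : X \subset E by apply/subsetP=> z; rewrite inE => /andP [].
have sUX : U \subset X.
  apply/subsetP=> t tU; have tS := subsetP sU t tU; rewrite inE (subsetP sSE) // r1 //=.
  by apply/exists_inP; exists t => //; apply: mem_cl; rewrite inE.
have sXc : X \subset cl U.
  apply/subsetP=> x; rewrite inE => /and3P [_ _ /exists_inP [t tU]].
  by apply: subsetP; apply: clS; rewrite sub1set.
have sUX' : S :\: U \subset E :\: X.
  apply/subsetP=> t; rewrite inE => /andP [tU tS]; rewrite inE (subsetP sSE) // andbT.
  apply/negP; rewrite inE => /and3P [_ _ /exists_inP [u uU /clP]].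
  have uS := subsetP sU u uU; rewrite r1 // r2 //; by apply: contraNneq tU => ->.
have sXc' : E :\: X \subset cl (S :\: U).
  apply/subsetP=> x; rewrite inE => /andP [xX xE].
  have [r0|r1x] : r [set x] = 0 \/ r [set x] = 1.
    by have := rk_card K [set x]; rewrite cards1; rlia.
    have s := sub0set (S :\: U); apply: (subsetP (clS K s)); apply/clP.
    by rewrite setU0 rk0.
  have [t tS /andP [xt _]] := rep x xE r1x.
  have tU : t \notin U.
    apply: contra xX => tU; rewrite inE xE r1x /=; by apply/exists_inP; exists t.
  by apply: subsetP xt; apply: clS; rewrite sub1set inE tU.
exists X; split; first split=> //.
- by apply/eqP; rewrite eqn_leq (rk_mono K sUX) andbT -(rk_cl K U) rk_mono.
- by apply/eqP; rewrite eqn_leq (rk_mono K sUX') andbT -(rk_cl K (S :\: U)) rk_mono.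
move=> a b; rewrite inE => /and3P [_ _ /exists_inP [t tU at']] bE rb ba.
rewrite inE bE rb /=; apply/exists_inP; exists t => //.
by apply: (subsetP (cl_min _) b ba); rewrite sub1set.
Qed.

(** Turns the size bounds of a separation of [si K] into rank bounds, which lift to [K]. *)
Lemma si_rk_ge U k : 0 < k < 3 -> U \subset ground (si K) -> k <= #|U| -> k <= r U.
Proof.
have [sSE _ r1 r2 rep] := si_spec => hk sU cU.
have /card_gt0P [t tU] : 0 < #|U| by rlia.
have := r1 t (subsetP sU t tU).
have : r [set t] <= r U by apply: rk_mono; rewrite sub1set.
case: (leqP k 1) => k1; first by rlia.
have /card_gt1P [a [b [aU bU ab]]] : 1 < #|U| by rlia.
have := r2 a b (subsetP sU a aU) (subsetP sU b bU) ab.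
have : r [set a; b] <= r U by apply: rk_mono; rewrite subUset !sub1set aU.
rlia.
Qed.

Lemma si_connected :
  (forall X k, X \subset E -> 0 < k < 3 -> k <= r X -> k <= r (E :\: X) ->
    r E + k <= r X + r (E :\: X)) ->
  connected (si K) 3.
Proof.
move=> V k U k0 k3 [sU lam c1 c2]; have [sSE rS _ _ _] := si_spec.
have hk : 0 < k < 3 by rewrite k0.
have [X [[sX _ rX _ rX'] _]] := si_lift sU.
have sU' : ground (si K) :\: U \subset ground (si K) by apply: subsetDl.
have := V X k sX hk; rewrite rX rX' => /(_ (si_rk_ge hk sU c1) (si_rk_ge hk sU' c2)).
move: lam; rewrite /lambda !rS //.
have := rk_mono K sSE; rlia.
Qed.

(** As [N] is simple, its copy uses no loops and at most one element of each parallel class.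
    Replacing elements by representatives and dropping the loops of [C] therefore preserves
    injectivity and all the ranks involved. *)
Lemma minor_via_si (T' : finType) (N : matroid T') C g :
  (forall y, y \in ground N -> rk N [set y] = 1) ->
  (forall y z, y \in ground N -> z \in ground N -> y != z -> rk N [set y; z] = 2) ->
  minor_via K N C g -> exists C' g', minor_via (si K) N C' g'.
Proof.
move=> n1 n2 [sC gi gE rg]; have [sSE rS r1 r2 rep] := si_spec.
set S := ground (si K) in sSE rS r1 r2 rep *.
(* The default only concerns loops, which [NL] keeps out. *)
pose rho x := odflt x [pick t in S | (x \in cl [set t]) && (t \in cl [set x])].
have rhoP x : x \in E -> r [set x] = 1 ->
    [/\ rho x \in S, x \in cl [set rho x] & rho x \in cl [set x]].
  move=> xE rx; rewrite /rho; case: pickP => [t /and3P [] //|no].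
  by have [t tS h] := rep x xE rx; have := no t; rewrite /= tS h.
pose NL := [set x in E | r [set x] == 1].
have rr Z : Z \subset E -> r (rho @: (Z :&: NL)) = r Z.
  move=> sZ; have p x : x \in Z :&: NL ->
      [/\ x \in Z, rho x \in S, x \in cl [set rho x] & rho x \in cl [set x]].
    rewrite in_setI => /andP [xZ]; rewrite in_set => /andP [xE /eqP rx].
    by have [] := rhoP x xE rx; split.
  apply/eqP; rewrite eqn_leq; apply/andP; split.
    rewrite -(rk_cl K Z); apply: rk_mono; apply/subsetP=> _ /imsetP [x xZ ->].
    have [xZ' _ _ h] := p x xZ; apply: subsetP h; apply: clS; rewrite sub1set //.
  rewrite -(rk_cl K (rho @: _)); apply: rk_mono; apply/subsetP=> x xZ.
  have xE := subsetP sZ x xZ.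
  have [r0|r1x] : r [set x] = 0 \/ r [set x] = 1.
    by have := rk_card K [set x]; rewrite cards1; rlia.
    have s := sub0set (rho @: (Z :&: NL)); apply: (subsetP (clS K s)); apply/clP.
    by rewrite setU0 rk0.
  have xN : x \in Z :&: NL by rewrite !inE xZ xE r1x.
  have [_ _ h _] := p x xN; apply: subsetP h; apply: clS; rewrite sub1set.
  exact: imset_f.
have gyE y : y \in ground N -> g y \in E.
  by move=> yN; have := subsetP gE (g y) (imset_f g yN); rewrite inE => /andP [].
have gyC y : y \in ground N -> g y \notin cl C.
  move=> yN; apply/negP => /clP h; have := rg [set y]; rewrite sub1set yN imset_set1 h n1 //.
  by move/(_ isT); rlia.
have gyr y : y \in ground N -> r [set g y] = 1.
  move=> yN; have := rk_card K [set g y]; rewrite cards1 => le.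
  suff /eqP : r [set g y] != 0 by rlia.
  apply: contra (gyC y yN) => /eqP r0; have s := sub0set C.
  by apply: (subsetP (clS K s)); apply/clP; rewrite setU0 rk0.
have gNL (Z : {set T'}) : Z \subset ground N -> g @: Z \subset NL.
  move=> sZ; apply/subsetP=> _ /imsetP [y yZ ->].
  have yN := subsetP sZ y yZ; by rewrite inE gyE ?gyr.
exists (rho @: (C :&: NL)), (rho \o g).
have im (Z : {set T'}) : Z \subset ground N -> (rho \o g) @: Z :|: rho @: (C :&: NL) = rho @: ((g @: Z :|: C) :&: NL).
  by move=> sZ; rewrite imset_comp -imsetU setIUl (setIidPl (gNL Z sZ)).
have sNS Z : Z \subset NL -> rho @: Z \subset S.
  move=> sZ; apply/subsetP=> _ /imsetP [x xZ ->].
  by have := subsetP sZ x xZ; rewrite inE => /andP [xE /eqP rx]; have [] := rhoP x xE rx.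
split.
- by apply: sNS; apply: subsetIr.
- move=> y z yN zN /= eyz; apply/eqP; apply: contraT => yz; exfalso.
  have [_ h1 h2] := rhoP (g y) (gyE y yN) (gyr y yN).
  have [_ h3 h4] := rhoP (g z) (gyE z zN) (gyr z zN).
  have h : g y \in cl [set g z].
    by apply: (subsetP (cl_min _) _ h1); rewrite eyz sub1set.
  have s : [set g z] \subset g z |: C by rewrite subsetUl.
  have /clP := subsetP (clS K s) _ h.
  have := rg [set y; z]; rewrite subUset !sub1set yN zN imsetU !imset_set1 n2 // => /(_ isT).
  by rewrite -setUA => <-; have := rkU1 K (g z) C; rlia.
- rewrite imset_comp subsetD; apply/andP; split; first by apply/sNS/gNL.
  rewrite disjoints_subset; apply/subsetP=> _ /imsetP [_ /imsetP [y yN ->] ->].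
  rewrite inE; apply/negP => /imsetP [c]; rewrite !inE => /and3P [cC cE' /eqP rc] e.
  have [_ h1 _] := rhoP (g y) (gyE y yN) (gyr y yN).
  have [_ _ h4] := rhoP c cE' rc.
  case/negP: (gyC y yN); rewrite e in h1.
  have t : [set rho c] \subset cl C.
    by rewrite sub1set; apply: subsetP h4; apply: clS; rewrite sub1set.
  exact: subsetP (cl_min t) _ h1.
move=> Z sZ; rewrite im //.
have sgZ : g @: Z :|: C \subset E.
  by rewrite subUset sC andbT; apply/subsetP=> _ /imsetP [y yZ ->]; apply/gyE/(subsetP sZ).
rewrite !rS ?sNS ?subsetIr // !rr //; exact: rg.
Qed.
End Simple.

(** * Duality, and translation between the two descriptions of minors *)

Lemma dual_rkE (T : finType) (K : matroid T) (X : {set T}) : X \subset ground K ->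
  rk (dual K) X + rk K (ground K) = #|X| + rk K (ground K :\: X).
Proof.
move=> sX; rewrite /= /dual_rk subnK ?dual_rk_sub //.
by rewrite (setIidPl sX).
Qed.

Lemma connected_dual (T : finType) (K : matroid T) n :
  connected K n -> connected (dual K) n.
Proof.
move=> c k X k0 kn [/= sX lam c1 c2]; apply: (c k X) => //; split=> //.
move: lam; rewrite /lambda.
have h1 := dual_rkE sX; have h2 := dual_rkE (subsetDl (ground K) X).
have h3 := dual_rkE (subxx (ground K)).
move: h2 h3; have -> : ground K :\: (ground K :\: X) = X by sset.
rewrite setDv rk0; have := cardsID X (ground K); rewrite (setIidPr sX).
have : ground (dual K) = ground K by [].
move=> -> e1 e2 e3.
have := rkU K X (ground K :\: X); have -> : X :|: (ground K :\: X) = ground K by sset.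
rlia.
Qed.

Section Witnesses.
Variables (T T' : finType) (K : matroid T) (N : matroid T').
Implicit Types (C D : {set T}) (g : T' -> T).

(** Double duals, and the two forms of a contraction, are compared only through the values of their
    rank functions; minors are transported along this agreement. *)
Lemma minor_via_eq_rk (K' : matroid T) (N' : matroid T') C g :
  ground K = ground K' -> rk K =1 rk K' -> ground N = ground N' -> rk N =1 rk N' ->
  minor_via K N C g -> minor_via K' N' C g.
Proof.
move=> eK rK eN rN [sC gi gE rg]; rewrite /minor_via -eK -eN; split=> // Z sZ.
by rewrite -rN -!rK rg.
Qed.

(** Dualizing exchanges contraction and deletion, so the new contracted set is the deleted set that
    [minor_via] leaves implicit. *)
Lemma minor_via_dual C g : minor_via K N C g ->
  minor_via (dual K) (dual N) (ground K :\: C :\: g @: ground N) g.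
Proof.
move=> [sC gi gE rg]; set D := _ :\: _ :\: _.
have dD : D = ground K :\: C :\: g @: ground N by [].
split=> //=; [by sset | by sset |].
move=> Z sZ; have sgZ : g @: Z \subset g @: ground N by apply: imsetS.
have := @dual_rkE _ K D ltac:(sset).
have := @dual_rkE _ K (g @: Z :|: D) ltac:(sset).
have := dual_rkE sZ.
have eD : ground K :\: D = g @: ground N :|: C by sset.
have eW : g @: (ground N :\: Z) = g @: ground N :\: g @: Z.
  apply/setP=> z; rewrite inE andbC.
  apply/imsetP/andP => [[y]|[/imsetP [y yN ->] yZ]].
    rewrite inE => /andP [yZ yN] ->; split; first exact: imset_f.
    apply/negP => /imsetP [u uZ /gi e]; move: yZ; rewrite e ?uZ //.
    exact: subsetP uZ.
  exists y => //; rewrite inE yN andbT; apply: contra yZ; exact: imset_f.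
have eZ : ground K :\: (g @: Z :|: D) = g @: (ground N :\: Z) :|: C.
  by rewrite eW; move: (g @: ground N) (g @: Z) gE sgZ dD => P Q *; sset.
have cZ : #|g @: Z :|: D| = #|Z| + #|D|.
  rewrite cardsU; have -> : g @: Z :&: D = set0 by sset.
  rewrite cards0 subn0 card_in_imset // => u v uZ vZ.
  by apply: gi; apply: (subsetP sZ).
rewrite eD eZ cZ -!rg ?subsetDl //=.
rlia.
Qed.

Lemma minor_via_of_has_minor : 0 < #|ground N| -> has_minor K N ->
  exists C g, minor_via K N C g.
Proof.
move=> /card_gt0P [y0 y0N] [C [D [sC sD dCD [f [fi fN fr]]]]].
have : y0 \in [set f x | x in [set: {x : T | x \in ground (delete (contract K C) D)}]].
  by rewrite fN.
move=> /imsetP [x0 _ _].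
(* The inverse of [f]; off the ground set of [N] any value will do, and [x0] exists because [N] is
   nonempty. *)
pose g y := if [pick x | f x == y] is Some x then val x else val x0.
have gf x : g (f x) = val x.
  by rewrite /g; case: pickP => [z /eqP /fi -> //|/(_ x)]; rewrite eqxx.
have onto y : y \in ground N -> exists x, y = f x.
  by rewrite -fN => /imsetP [x _ ->]; exists x.
exists C, g; split=> //.
- move=> u v /onto [x ->] /onto [y ->]; rewrite !gf => e; congr f; exact: val_inj.
- apply/subsetP=> _ /imsetP [y /onto [x ->] ->]; rewrite gf.
  by have := valP x; rewrite /= !inE => /andP [].
move=> Z sZ; pose X := [set x | f x \in Z].
have eZ : f @: X = Z.
  apply/setP=> z; apply/imsetP/idP => [[x]|zZ]; first by rewrite inE => h ->.
  have [x e] := onto z (subsetP sZ z zZ); exists x => //.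
  by rewrite inE -e.
have egZ : val @: X = g @: Z.
  rewrite -eZ -imset_comp; apply: eq_imset => x; by rewrite /= gf.
have := fr X; rewrite eZ egZ /= /del_rk /con_rk => ->.
have -> : g @: Z :\: D = g @: Z.
  apply/setDidPl; rewrite disjoints_subset; apply/subsetP=> z.
  rewrite -egZ => /imsetP [x _ ->]; have := valP x; by rewrite /= !inE => /andP [].
by rewrite subnK //; apply: rk_mono; apply: subsetUr.
Qed.

Lemma has_minor_of_minor_via C g : 0 < #|ground N| -> minor_via K N C g -> has_minor K N.
Proof.
move=> /card_gt0P [y0 y0N] [sC gi gE rg].
pose D := ground K :\: C :\: g @: ground N.
have eG : ground (delete (contract K C) D) = g @: ground N.
  by rewrite /= /D; sset.
exists C, D; split=> //; first by rewrite /D; sset.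
  by rewrite disjoint_sym disjoints_subset /D; sset.
pose f (x : {x : T | x \in ground (delete (contract K C) D)}) :=
  odflt y0 [pick y in ground N | g y == val x].
have fP x : f x \in ground N /\ g (f x) = val x.
  rewrite /f; case: pickP => [y /andP [yN /eqP e] //|no].
  have : val x \in g @: ground N by rewrite -eG; apply: valP.
  move=> /imsetP [y yN e].
  by have := no y; rewrite /= yN e eqxx.
have fi : injective f.
  move=> x y e; apply: val_inj; by rewrite -(proj2 (fP x)) e (proj2 (fP y)).
exists f; split=> //.
  apply/setP=> y; apply/imsetP/idP => [[x _ ->]|yN]; first by have [] := fP x.
  have gy : g y \in ground (delete (contract K C) D) by rewrite eG imset_f.
  exists (exist _ (g y) gy) => //; have [h1 h2] := fP (exist _ (g y) gy).
  by apply: gi => //; rewrite h2.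
move=> X; have sX : f @: X \subset ground N.
  by apply/subsetP=> _ /imsetP [x _ ->]; have [] := fP x.
have eX : g @: (f @: X) = val @: X.
  by rewrite -imset_comp; apply: eq_imset => x; have [] := fP x.
have := rg _ sX; rewrite eX /= /del_rk /con_rk => h.
have -> : val @: X :\: D = val @: X.
  apply/setDidPl; rewrite disjoints_subset; apply/subsetP=> _ /imsetP [x _ ->].
  have : val x \in g @: ground N by rewrite -eG; apply: valP.
  by rewrite /D !inE => ->.
by rewrite -h addnK.
Qed.
End Witnesses.

Lemma dual_dual_rk (T : finType) (N : matroid T) : rk (dual (dual N)) =1 rk N.
Proof.
move=> X; rewrite rk_ground [RHS]rk_ground /=.
have sX : X :&: ground N \subset ground N := subsetIr _ _.
move: (X :&: ground N) sX => Z sZ.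
have h1 := @dual_rkE _ (dual N) Z sZ.
have h2 := @dual_rkE _ N (ground N :\: Z) (subsetDl _ _).
have h3 := @dual_rkE _ N (ground N) (subxx _).
move: h1 h2 h3; have -> : ground (dual N) = ground N by [].
have -> : ground N :\: (ground N :\: Z) = Z by sset.
rewrite setDv rk0; have := cardsID Z (ground N); rewrite (setIidPr sZ).
rewrite /=; rlia.
Qed.

(** * From vertical separations of M to connectivity of the simplified contraction *)

(* [K] is [M / x], up to extensional equality of the rank functions. *)
Section Contraction.
Variables (T : finType) (M K : matroid T) (x : T).
Local Notation E := (ground M).
Local Notation r := (rk M).
Implicit Types (X Y Z U L : {set T}).
Hypotheses (M3 : connected M 3) (cE : 3 < #|E|) (xE : x \in E).
Hypotheses (eK : ground K = E :\ x) (rK : forall Z : {set T}, (rk K Z).+1 = r (x |: Z)).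

Lemma contraction_conn1 X : X \subset ground K -> 0 < rk K X ->
  0 < rk K (ground K :\: X) -> rk K (ground K) < rk K X + rk K (ground K :\: X).
Proof.
rewrite eK => sX rX rY; have h1 := rK X; have h2 := rK (E :\ x :\: X); have h3 := rK (E :\ x).
rewrite setD1K // in h3.
have cX := leq_trans rX (rk_card K X); have cY := leq_trans rY (rk_card K _).
have sX' : X \subset E := subset_trans sX (subsetDl _ _).
have xX : x \notin X by apply/negP => /(subsetP sX); rewrite !inE eqxx.
have card3 : #|X| + #|E :\ x :\: X| = #|E :\ x|.
  by rewrite -(cardsID X (E :\ x)) (setIidPr sX).
have := cardsD1 x E; rewrite xE => cE1.
(* [x] joins [X] if [X] has at most one element and the other side otherwise; with |E| at least 4,
   both sides then have two elements. *)
have [c|c] := leqP #|X| 1.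
  have : (r E).+2 <= r (x |: X) + r (E :\ x :\: X).
    apply: conn2 => //; first by sset.
      have -> : E :\: (E :\ x :\: X) = x |: X by sset.
      by rewrite cardsU1 xX; rlia.
    have -> : E :\: (x |: X) = E :\ x :\: X by sset.
    rlia.
  by rkmono M (E :\ x :\: X) (x |: (E :\ x :\: X)); rlia.
have : (r E).+2 <= r X + r (x |: (E :\ x :\: X)).
  apply: conn2 => //; first by sset.
    by apply: leq_trans c (subset_leq_card _); sset.
  have -> : E :\: X = x |: (E :\ x :\: X) by sset.
  by rewrite cardsU1 !inE eqxx andbF /=; rlia.
by rkmono M X (x |: X); rlia.
Qed.

(** If the bound failed, [k1] and [k2], with [x] on either side, would leave no room for [x] to
    raise the rank of either side; then [X] would be a vertical 3-separation at [x]. *)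
Lemma contraction_vertical X : ~~ vsep_point M x -> X \subset ground K -> 1 < rk K X ->
  1 < rk K (ground K :\: X) -> (rk K (ground K)).+2 <= rk K X + rk K (ground K :\: X).
Proof.
move=> nb; rewrite eK => sX rX rY.
have h1 := rK X; have h2 := rK (E :\ x :\: X); have h3 := rK (E :\ x).
rewrite setD1K // in h3.
rewrite ltnNge; apply/negP => le.
have xX : x \notin X by apply/negP => /(subsetP sX); rewrite !inE eqxx.
have cX := leq_trans rX (rk_card K X); have cY := leq_trans rY (rk_card K _).
have k1 : (r E).+2 <= r X + r (x |: (E :\ x :\: X)).
  apply: conn2 => //; first by sset.
    by apply: leq_trans cX (subset_leq_card _); sset.
  by apply: leq_trans cY (subset_leq_card _); sset.
have k2 : (r E).+2 <= r (x |: X) + r (E :\ x :\: X).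
  apply: conn2 => //; first by sset.
    by apply: leq_trans cX (subset_leq_card _); sset.
  by apply: leq_trans cY (subset_leq_card _); sset.
have m1 : r X <= r (x |: X) by apply/rk_mono/subsetUr.
have m2 : r (E :\ x :\: X) <= r (x |: (E :\ x :\: X)) by apply/rk_mono/subsetUr.
case/negP: nb; apply/existsP; exists X; apply/vsepP; split; split=> //.
- exact: subset_trans sX (subsetDl _ _).
- by rlia.
- by rlia.
- by rlia.
- by apply/clP; rlia.
- by apply/clP; rlia.
Qed.

Lemma si_contraction_connected : ~~ vsep_point M x -> connected (si K) 3.
Proof.
move=> nb; apply: si_connected => X k sX.
case: k => [//|[|[|//]]] _ rX rY.
  by rewrite addn1; apply: contraction_conn1.
by rewrite addn2; apply: contraction_vertical.
Qed.

Lemma si_rk_ground : rk K (ground (si K)) = rk K (ground K).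
Proof.
have [X [[sX _ rX _ rX'] _]] := si_lift (subxx (ground (si K))).
move: rX'; rewrite setDv rk0; have := rkU K X (ground K :\: X).
have -> : X :|: (ground K :\: X) = ground K by sset.
have := rk_leE K (ground (si K)); rlia.
Qed.

(** The elements of [L :\ x] are parallel in [K], so the lift of the side containing their
    representative [t0] contains them all. What remains is the last clause of [series_point], up to
    the position of [h]. *)
Lemma series_point_no_split L h : x \in L -> L \subset E -> h \in E :\: L -> r L <= 2 ->
  let Y := E :\: L :\ h in h \notin mclosure M (x |: Y) ->
  (forall U : {set T}, U \subset Y -> U != set0 -> 1 < #|Y :\: U| ->
     (r E).+2 < r (x |: (Y :\: U)) + r (U :|: (h |: L))) ->
  forall U t0 l0, let S := ground (si K) in U \subset S -> t0 \in U -> l0 \in L :\ x ->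
  l0 \in mclosure K [set t0] -> t0 \in mclosure K [set l0] -> 2 < #|U| -> 2 < #|S :\: U| ->
  rk K (ground K) < rk K U + rk K (S :\: U) -> 
  (rk K (ground K)).+1 < rk K U + rk K (S :\: U).
Proof.
move=> xL sL hEL rL Y hY sepY U t0 l0 S sU t0U l0L lt tl cU cV lam.
have [sSE rS r1 r2 _] := si_spec K; rewrite -/S in sSE rS r1 r2.
have dY : Y = E :\: L :\ h by [].
have [X [[sX sUX rX sVX rX'] parX]] := si_lift sU; rewrite -/S in sVX rX'.
have [hE hL] : h \in E /\ h \notin L by apply/andP; rewrite andbC -in_setD.
have xX : x \notin X by apply/negP => /(subsetP sX); rewrite eK !inE eqxx.
have l0x : l0 \in L /\ l0 != x by apply/andP; rewrite andbC -in_setD1.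
have [{}l0L l0nx] := l0x.
have rKl l : l \in L -> l != x -> rk K [set l] = 1.
  move=> lL lx; have := rK [set l]; rewrite (rk2E M3 cE) //; [by case | | by rewrite eq_sym].
  exact: subsetP lL.
have lE l : l \in L -> l != x -> l \in ground K.
  by move=> lL lx; rewrite eK !inE lx (subsetP sL).
have l0X : l0 \in X.
  by apply: parX (subsetP sUX _ t0U) (lE _ l0L l0nx) (rKl _ l0L l0nx) lt.
have lcl l : l \in L -> l != x -> l \in mclosure K [set l0].
  move=> lL lx; apply/clP; rewrite (rKl l0) //.
  have := rK (l |: [set l0]); have := rK [set l0]; rewrite (rKl l0) // => e1.
  have : r (x |: (l |: [set l0])) <= r L.
    by apply: rk_mono; rewrite !subUset !sub1set xL lL l0L.
  rkmono K [set l0] (l |: [set l0]); rewrite (rKl l0) //; rlia.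
have sLX : L :\ x \subset X.
  apply/subsetP=> l; rewrite !inE => /andP [lx lL].
  exact: parX l0X (lE _ lL lx) (rKl _ lL lx) (lcl _ lL lx).
have Lt t : t \in U -> t \in L -> t = t0.
  move=> tU tL; apply/eqP; apply: contraT => tt0.
  have tx : t != x by apply: contraTneq tU => ->; apply: contra xX; apply: (subsetP sUX).
  have s : [set t; t0] \subset mclosure K [set l0] by rewrite subUset !sub1set lcl.
  have := rk_mono K s; rewrite rk_cl (rKl l0) // r2 //; exact: (subsetP sU).
pose U' := X :\: L :\ h; have dU' : U' = X :\: L :\ h by [].
have sXE : X \subset E by apply: subset_trans sX _; rewrite eK subsetDl.
have sU' : U' \subset Y by rewrite dU' dY; apply: setSD; apply: setSD.
(* Of the three elements of [U], only [t0] can lie in [L] and at most one is [h]. *)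
have Un : U' != set0.
  have /card_gt0P [u] : 0 < #|U :\ t0 :\ h|.
    by have := cardsD1 t0 U; have := cardsD1 h (U :\ t0); rewrite t0U; case: (h \in _) => /=; rlia.
  rewrite !inE => /and3P [uh ut0 uU]; apply/set0Pn; exists u.
  rewrite !inE uh (subsetP sUX) // andbT /=.
  by apply: contra ut0 => uL; rewrite (Lt u uU uL).
have cYU : 1 < #|Y :\: U'|.
  apply: leq_trans (_ : 1 < #|(S :\: U) :\ h|) (subset_leq_card _).
    by have := cardsD1 h (S :\: U); case: (h \in _) => /=; rlia.
  apply/subsetP=> z; rewrite in_setD1 => /andP [zh /(subsetP sVX)].
  rewrite in_setD eK in_setD1 => /and3P [zX zx zE].
  rewrite !inE zh zE (negbTE zX) !andbF /= andbT; apply: contra zX => zL.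
  by apply: (subsetP sLX); rewrite !inE zx.
have := sepY U' sU' Un cYU; rewrite -rX -rX'.
have h1 := rK X; have h2 := rK (ground K :\: X); have h3 := rK (ground K).
rewrite {2}eK setD1K // in h3.
have YX z : z \in Y :\: U' -> z \in ground K :\: X.
  rewrite eK !inE => /and4P [zU' zh zL zE]; rewrite zE andbT.
  rewrite zh zL /= in zU'; rewrite zU' /=.
  by apply: contraNneq zL => ->.
have LX : L \subset x |: X by rewrite -(setD1K xL); apply: setUS.
have UX : U' \subset x |: X by rewrite dU'; sset.
(* The clause counts [h] with [L]. If [h] is on the other side, moving it there adds exactly one to
   that rank, as [hY] holds, and takes at most one from the rank it leaves. *)
case: (boolP (h \in X)) => hX.
  have : r (x |: (Y :\: U')) <= r (x |: (ground K :\: X)).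
    by apply/rk_mono/setUS/subsetP.
  have : r (U' :|: (h |: L)) <= r (x |: X).
    by apply: rk_mono; rewrite !subUset UX LX sub1set !inE hX orbT.
  rlia.
have hKX : h \in ground K :\: X.
  by rewrite eK !inE hX hE andbT; apply: contraNneq hL => ->.
have hYU : h \notin mclosure M (x |: (Y :\: U')).
  apply: contra hY; apply: subsetP; apply: clS; apply: setUS; exact: subsetDl.
have := notclP hYU.
have : r (h |: (x |: (Y :\: U'))) <= r (x |: (ground K :\: X)).
  apply: rk_mono; rewrite subUset sub1set in_setU1 hKX orbT; apply/setUS/subsetP/YX.
have : r (U' :|: (h |: L)) <= (r (x |: X)).+1.
  have -> : U' :|: (h |: L) = h |: (U' :|: L) by rewrite setUCA.
  apply: leq_trans (rkU1 _ _ _) _; rewrite ltnS; apply: rk_mono.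
  by rewrite subUset UX LX.
rlia.
Qed.

(** Connectivity is self-dual, so 1-separations are excluded as before. A 2-separation has the
    representative of [L :\ x] on one of its sides, and [series_point_no_split] applies to that
    side. *)
Lemma co_si_contraction_connected : series_point M x -> connected (si (dual (si K))) 3.
Proof.
move=> [L [h [[xL cL sL hE] [rL hY sepY]]]].
set S := ground (si K).
have [sSE rS r1 r2 rep] := si_spec K; rewrite -/S in sSE rS r1 r2 rep.
have rS0 := si_rk_ground; rewrite -/S in rS0.
apply: si_connected => X k; have -> : ground (dual (si K)) = S by [].
move=> sX k3.
have sXc : S :\: X \subset S := subsetDl _ _.
have e1 := @dual_rkE _ (si K) X sX; have e2 := @dual_rkE _ (si K) _ sXc.
have e3 := @dual_rkE _ (si K) S (subxx S).
rewrite -/S setDv rk0 in e1 e2 e3.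
have eX : S :\: (S :\: X) = X by sset.
rewrite eX !rS // rS0 in e1 e2 e3.
have cS := cardsID X S; rewrite (setIidPr sX) in cS.
move: e1 e2 e3; set dX := rk (dual (si K)) X; set dY := rk (dual (si K)) (S :\: X);
  set dS := rk (dual (si K)) S => e1 e2 e3 kX kY.
have cX : 0 < #|X|.
  rewrite card_gt0; apply: contraTneq kX => X0; rewrite -ltnNge; move: e1.
  by rewrite X0 cards0 setD0 rS0; rlia.
have cY : 0 < #|S :\: X|.
  rewrite card_gt0; apply: contraTneq kY => Y0; rewrite -ltnNge; move: e2.
  have := rk_leE K X; by rewrite Y0 cards0; rlia.
have gX := si_rk_ge (isT : 0 < 1 < 3) sX cX; have gY := si_rk_ge (isT : 0 < 1 < 3) sXc cY.
have conn : rk K (ground K) < rk K X + rk K (S :\: X).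
  have [X' [[sX' _ rX' _ rY'] _]] := si_lift sX.
  by rewrite -rX' -rY'; apply: contraction_conn1; rewrite ?rX' ?rY'.
case: (ltnP k 2) => k2; first by rlia.
suff : (rk K (ground K)).+1 < rk K X + rk K (S :\: X) by rlia.
rewrite ltnNge; apply/negP=> le.
(* In a 2-separation, dual rank at least 2 makes a side dependent in [si K], and a dependent set of
   a simple matroid has at least three elements. This sets the series pairs aside. *)
have big (V : {set T}) : V \subset S -> rk K V < #|V| -> 0 < rk K V -> 2 < #|V|.
  move=> sV lt gt; have c : 1 < #|V| by rlia.
  have := si_rk_ge (isT : 0 < 2 < 3) sV c; rlia.
have bX : 2 < #|X| by apply: big => //; rlia.
have bY : 2 < #|S :\: X| by apply: big => //; rlia.
have [l lL] : exists l, l \in L :\ x.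
  by apply/set0Pn; rewrite -card_gt0; have := cardsD1 x L; rewrite xL; rlia.
have [lx lL'] : l != x /\ l \in L by apply/andP; rewrite -in_setD1.
have lE : l \in ground K by rewrite eK !inE lx (subsetP sL).
have rl : rk K [set l] = 1.
  have := rK [set l]; rewrite (rk2E M3 cE) //; [by case | | by rewrite eq_sym].
  exact: subsetP lL'.
have [t tS /andP [lt tl]] := rep l lE rl.
case: (boolP (t \in X)) => tX.
  have := series_point_no_split xL sL hE rL hY sepY sX tX lL lt tl bX bY conn.
  by rewrite ltnNge le.
have tY : t \in S :\: X by rewrite inE tX.
have := series_point_no_split xL sL hE rL hY sepY sXc tY lL lt tl bY; rewrite -/S eX addnC.
by move=> /(_ bX conn); rewrite ltnNge le.
Qed.
End Contraction.

(** * Transfer from the dual *)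

Theorem theorem1p3 (T T' : finType) (M : matroid T) (N : matroid T')
    (C : {set T}) :
  connected M 3 -> connected N 3 -> 4 <= #|ground N| ->
  circuit M C ->
  (exists2 x0, x0 \in C & has_minor (delete M [set x0]) N) ->
  [\/ exists2 x, x \in C &
        connected (co (delete M [set x])) 3 /\
        has_minor (co (delete M [set x])) N,
      exists2 x, x \in C &
        connected (si (co (delete M [set x]))) 3 /\
        has_minor (si (co (delete M [set x]))) N
    | exists x1 x2 x3 x4,
        [/\ fan4 M x1 x2 x3 x4, x2 \in C, x4 \in C,
            connected (co (delete M [set x3])) 3
          & has_minor (co (delete M [set x3])) N]].
Proof.
move=> M3 N3 cN /circuitE [sC rC minC] [x0 x0C hm].
pose M' := dual M; pose N' := dual N.
have eM : ground M' = ground M by [].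
have M3' : connected M' 3 := connected_dual M3.
have N3' : connected N' 3 := connected_dual N3.
have cN0 : 0 < #|ground N| by apply: leq_trans cN.
have x0E := subsetP sC x0 x0C.
pose K x := dual (delete M [set x]).
have cE : 3 < #|ground M|.
  have [C0 [g [_ gi gE _]]] := minor_via_of_has_minor cN0 hm.
  apply: leq_trans cN _; rewrite -(card_in_imset gi); apply: subset_leq_card.
  by apply: subset_trans gE _; rewrite /=; sset.
have eK x : ground (K x) = ground M' :\ x by [].
(* [K x] is [M'] contracted by [x]; the successor is the rank of [x] in [M'], as 3-connectedness
   prevents [x] from being a coloop of [M]. *)
have rK x (Z : {set T}) : x \in ground M -> (rk (K x) Z).+1 = rk M' (x |: Z).
  move=> xE; rewrite rk_ground [RHS]rk_ground eK eM.
  have -> : (x |: Z) :&: ground M = x |: (Z :&: (ground M :\ x)) by sset.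
  have sW : Z :&: (ground M :\ x) \subset ground M :\ x := subsetIr _ _.
  move: (Z :&: _) sW => W sW.
  have sxW : x |: W \subset ground M by sset.
  have := @dual_rkE _ (delete M [set x]) W sW; have := dual_rkE sxW.
  have hd (V : {set T}) : rk (delete M [set x]) V = rk M (V :\: [set x]) by [].
  have -> : ground (delete M [set x]) = ground M :\ x by [].
  rewrite !hd -/(K x) -/M'.
  have -> : ground M :\ x :\ x = ground M :\ x by sset.
  have xW : x \notin W by apply/negP => /(subsetP sW); rewrite !inE eqxx.
  have -> : ground M :\: (x |: W) = ground M :\: [set x] :\: W :\: [set x] by sset.
  rewrite cardsU1 xW.
  have : (rk M (ground M)).+1 <= rk M [set x] + rk M (ground M :\ x).
    apply: conn1 => //; first by sset.
      by rewrite card_gt0; apply/set0Pn; exists x; rewrite !inE xE eqxx.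
    by have := cardsD1 x (ground M); rewrite xE; rlia.
  have := rk_card M [set x]; rewrite cards1; have := rk_leE M (ground M :\ x).
  rlia.
(* The circuit [C] is a cocircuit of [M']: independence of [C :\ c] makes [c] raise the dual
   rank. *)
have flatC c : c \in C -> c \notin mclosure M' (ground M' :\: C).
  move=> cC; apply/negP => /clP; rewrite eM.
  have s1 : c |: (ground M :\: C) \subset ground M.
    by rewrite subUset sub1set (subsetP sC) // subsetDl.
  have := dual_rkE s1; have := dual_rkE (subsetDl (ground M) C).
  have -> : ground M :\: (ground M :\: C) = C by sset.
  have -> : ground M :\: (c |: (ground M :\: C)) = C :\ c by sset.
  rewrite (minC c cC) cardsU1 !inE cC /= -/M'.
  have := cardsD1 c C; rewrite cC; rlia.
have rcon x : x \in ground M -> rk (K x) =1 rk (contract M' [set x]).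
  move=> xE Z; rewrite /= /con_rk setUC.
  have := rK x Z xE; have := rK x set0 xE; rewrite rk0 setU0 => <- <-.
  by rewrite subn1.
have via_contractible x : x \in ground M -> (exists D g, minor_via (K x) N' D g) <-> contractible M' N' x.
  move=> xE; have xE' : x \in ground M' := xE; split=> [[D [g w]]|[D [g [w xD]]]].
    have xD : x \notin D.
      by have [sD _ _ _] := w; apply/negP => /(subsetP sD); rewrite !inE eqxx.
    exists (x |: D), g; split; last exact: setU11.
    apply/(minor_via_contractP N' g xE' (setU11 x D)); rewrite setU1K //.
    by apply: minor_via_eq_rk w => //; apply: rcon.
  exists (D :\ x), g; have /(minor_via_contractP N' g xE' xD) w' := w.
  by apply: minor_via_eq_rk w' => // Z; rewrite rcon.
have has_x0 : contractible M' N' x0.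
  apply/via_contractible => //; have [D [g w]] := minor_via_of_has_minor cN0 hm.
  by exists (ground (delete M [set x0]) :\: D :\: g @: ground N), g; apply: minor_via_dual.
have si_ok x : x \in ground M -> ~~ vsep_point M' x -> connected (co (delete M [set x])) 3.
  move=> xE nb; apply: connected_dual.
  by apply: (@si_contraction_connected _ M' _ x) => // Z; apply: rK.
have minor_ok x : x \in ground M -> contractible M' N' x ->
    exists D g, minor_via (co (delete M [set x])) N D g.
  move=> xE /(via_contractible x xE) [D [g w]].
  have [||D' [g' w']] := minor_via_si _ _ w.
  - by move=> y; apply: (rk1E N3').
  - by move=> y z; apply: (rk2E N3').
  have := minor_via_dual w'; set D'' := _ :\: _ => w''; exists D'', g'.
  by apply: minor_via_eq_rk w'' => //; apply: dual_dual_rk.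
have [[x xC [hx nb]]|[x xC [hx sx]]|] := contraction_outcome_holds M3' cE sC flatC N3' cN x0C has_x0.
- have xE := subsetP sC x xC.
  have [D [g w]] := minor_ok x xE hx.
  apply: Or31; exists x => //; split; first exact: si_ok.
  exact: has_minor_of_minor_via w.
- have xE := subsetP sC x xC.
  have [D [g w]] := minor_ok x xE hx.
  apply: Or32; exists x => //; split.
    by apply: (@co_si_contraction_connected _ M' _ x) => // Z; apply: rK.
  have [||D' [g' w']] := minor_via_si _ _ w; [exact: rk1E N3 cN | exact: rk2E N3 cN |].
  exact: has_minor_of_minor_via w'.
move=> [y1 [y2 [y3 [y4 [[u s r3 rS] y1C y3C hy nb]]]]].
have [yE1 yE2 yE3 yE4] : [/\ y1 \in ground M, y2 \in ground M, y3 \in ground M & y4 \in ground M].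
  by split; apply: (subsetP s); rewrite !inE eqxx ?orbT.
have [D [g w]] := minor_ok y2 yE2 hy.
(* Pairs are independent in such a matroid, so rank at most 2 already makes three elements a
   circuit. *)
have circuit3 (L : matroid T) a b c : connected L 3 -> 3 < #|ground L| ->
    uniq [:: a; b; c] -> a \in ground L -> b \in ground L -> c \in ground L ->
    rk L [set a; b; c] <= 2 -> circuit L [set a; b; c] && (#|[set a; b; c]| == 3).
  move=> L3 cL /=; rewrite !inE negb_or andbT => /andP [/andP [ab ac] bc] aL bL cL' rL.
  have c3 : #|[set a; b; c]| = 3.
    by rewrite setUC cardsU1 cards2 !inE negb_or ![c == _]eq_sym ac bc ab.
  rewrite c3 eqxx andbT; apply/circuitE; split; first by rewrite !subUset !sub1set aL bL cL'.
    by rewrite c3; rlia.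
  have pair p q z : [set a; b; c] :\ z = [set p; q] -> p \in ground L -> q \in ground L ->
      p != q -> rk L ([set a; b; c] :\ z) = #|[set a; b; c] :\ z|.
    by move=> -> pL qL pq; rewrite (rk2E L3 cL) // cards2 pq.
  move=> z; rewrite !inE => /orP [/orP [/eqP ->|/eqP ->]|/eqP ->].
  - apply: (pair b c) => //; apply/setP=> z'; rewrite !inE.
    by case: (eqVneq z' a) => [->|] //=; rewrite (negbTE ab) (negbTE ac).
  - apply: (pair a c) => //; apply/setP=> z'; rewrite !inE.
    by case: (eqVneq z' b) => [->|] /=; rewrite ?orbF // eq_sym (negbTE ab) (negbTE bc).
  - apply: (pair a b) => //; apply/setP=> z'; rewrite !inE.
    by case: (eqVneq z' c) => [->|] /=; rewrite ?orbF // ![c == _]eq_sym (negbTE ac) (negbTE bc).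
(* The order is reversed because the triad of [M'] is the triangle of [M]. *)
apply: Or33; exists y4, y3, y2, y1; split=> //; [|exact: si_ok|exact: has_minor_of_minor_via w].
have u' : uniq [:: y4; y3; y2; y1] by rewrite -(rev_uniq [:: y4; y3; y2; y1]).
split=> //.
- apply: circuit3 => //; first by move: u'; rewrite (cat_uniq [:: y4; y3; y2] [:: y1]) => /and3P [].
  have sS : [set y4; y3; y2] \subset ground M by rewrite !subUset !sub1set yE2 yE3 yE4.
  have := dual_rkE (subsetDl (ground M) [set y4; y3; y2]); have := dual_rkE (subxx (ground M)).
  have -> : ground M :\: (ground M :\: [set y4; y3; y2]) = [set y4; y3; y2] by sset.
  have := cardsID [set y4; y3; y2] (ground M); rewrite (setIidPr sS) setDv rk0.
  have e : [set y2; y3; y4] = [set y4; y3; y2].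
    by apply/setP=> z; rewrite !inE; case: (z == y2); case: (z == y3); case: (z == y4).
  rewrite e eM in rS; rewrite -/M'.
  have c3 : #|[set y4; y3; y2]| <= 3.
    apply: leq_trans (leq_card_setU _ _) _; rewrite cards1 addn1 ltnS cards2.
    by case: (_ != _).
  rlia.
- have e : [set y3; y2; y1] = [set y1; y2; y3].
    by apply/setP=> z; rewrite !inE; case: (z == y1); case: (z == y2); case: (z == y3).
  rewrite /triad /cocircuit e; apply: circuit3 => //.
  by move: u; rewrite (cat_uniq [:: y1; y2; y3] [:: y4]) => /and3P [].
Qed.
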